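(* Let $\mathcal X=\{\mathbf x\in\mathbb R^n:A\mathbf x\le\mathbf b\}$ be a non-empty polytope (i.e. bounded), where $A\in\mathbb R^{m\times n}$ and $\mathbf b\in\mathbb R^m$. Then the Łojasiewicz exponent of $\mathcal X$ is $1$: there is $c>0$ such that $\mathbf d(\mathbf x,\mathcal X)\le c\max\{0,(A\mathbf x-\mathbf b)_j:j\in[m]\}$ for all $\mathbf x\in\mathbb B_R$. Consequently: 1. for any fixed positive integer $k$, $\mathbf d_k(\mathcal T(\mathcal X)_{2r})=O(1/r)$ as $r\to\infty$; 2. the convergence rates of the reduced moment-SOS hierarchy and of the Schmüdgen-type moment-SOS hierarchy are $O(1/r)$: for every $f\in\mathbb R[\mathbf x]$ with $f_{\min}=\min_{\mathcal X}f$, the quantities $f_{\min}-\mathrm{mlb}(f,\mathcal R(\mathcal X))_r$, $f_{\min}-\mathrm{lb}(f,\mathcal R(\mathcal X))_r$, $f_{\min}-\mathrm{mlb}(f,\mathcal T(\mathcal X))_r$ and $f_{\min}-\mathrm{lb}(f,\mathcal T(\mathcal X))_r$ are all $O(1/r)$.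
   Context: Standing convention: for some $R\ge1$ with $\mathcal X\subset\mathbb B_R=\{\|\mathbf x\|\le R\}$, the redundant ball constraint is added to the description, i.e. $\mathcal X$ is described by $g_0=R^2-\|\mathbf x\|^2\ge0$ and $g_j(\mathbf x)=b_j-(A\mathbf x)_j\ge0$, $j\in[m]$. There are no equality constraints, so the reduced certificate $\mathcal R(\mathcal X)_{2r}$ coincides with the truncated preordering $\mathcal T(\mathcal X)_{2r}$ (and the two hierarchies coincide). Notation: $[m]=\{1,\dots,m\}$; $\mathbf d(\mathbf x,\mathcal X)=\inf_{\mathbf y\in\mathcal X}\|\mathbf x-\mathbf y\|$; $\lceil g\rceil=\lceil(\deg g)/2\rceil$; for $J\subset\{0,\dots,m\}$, $g_J=\prod_{j\in J}g_j$, $g_\emptyset=1$; $\Sigma[\mathbf x]_{2s}$ = sums of squares of degree $\le2s$; $\mathbb N^n_k=\{\alpha\in\mathbb N^n:|\alpha|\le k\}$. $\mathcal R(\mathcal X)_{2r}=\mathcal T(\mathcal X)_{2r}=\{\sum_{J,\lceil g_J\rceil\le r}\sigma_Jg_J:\sigma_J\in\Sigma[\mathbf x]_{2(r-\lceil g_J\rceil)}\}$; $\mathrm{lb}(f,\cdot)_r=\sup\{a\in\mathbb R:f-a\in(\cdot)_{2r}\}$. For $y=(y_\alpha)_{\alpha\in\mathbb N^n_{2r}}$, $\ell_y(f)=\sum f_\alpha y_\alpha$, $\mathbf M_t(gy)=(\ell_y(g\,\mathbf x^{\alpha+\beta}))_{\alpha,\beta\in\mathbb N^n_t}$, $\mathbf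 M_t(y)=\mathbf M_t(1\,y)$; $\mathcal M(\mathcal R(\mathcal X)_{2r})=\mathcal M(\mathcal T(\mathcal X)_{2r})=\{y:y_0=1,\mathbf M_r(y)\succeq0,\mathbf M_{r-\lceil g_J\rceil}(g_Jy)\succeq0\ \forall J\subset\{0,\dots,m\},\lceil g_J\rceil\le r\}$; $\mathrm{mlb}(f,\cdot)_r$ is the infimum of $\ell_y(f)$ over this set. $\mathcal M_k(\mathcal T(\mathcal X)_{2r})$ is the image of $\mathcal M(\mathcal T(\mathcal X)_{2r})$ under restriction to indices in $\mathbb N^n_k$; $\mathcal M_k(\mathcal X)=\{(\int\mathbf x^\alpha d\nu)_{\alpha\in\mathbb N^n_k}:\nu\text{ a probability measure on }\mathcal X\}$; $\mathbf d_k(\mathcal T(\mathcal X)_{2r})=\sup\{\inf_{z\in\mathcal M_k(\mathcal X)}\|y-z\|:y\in\mathcal M_k(\mathcal T(\mathcal X)_{2r})\}$. *)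

(* Defs.v *)
From HB Require Import structures.
From mathcomp Require Import all_boot all_order all_algebra.
From mathcomp Require Import all_classical all_reals all_analysis.
(* The notations of mpoly conflict with those of MathComp-Analysis. *)
From mathcomp Require Import -(notations) mpoly.

Set Implicit Arguments.
Unset Strict Implicit.
Unset Printing Implicit Defensive.

Import Order.TTheory GRing.Theory Num.Theory.
Import numFieldNormedType.Exports.

Local Open Scope classical_set_scope.
Local Open Scope ring_scope.

Notation "{ 'mpoly' R [ n ] }" := (mpoly n R)
  (at level 0, R, n at level 2, format "{ 'mpoly'  R [ n ] }") : type_scope.

(* {alpha in N^n : |alpha| <= k}, as a finType *)
Notation exponents n k := (bmultinom n k.+1).

Section Euclidean.
Variable R : realType.

(* The library norm on matrices is the sup norm. *)
Definition enorm (I : finType) (v : I -> R) : R :=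
  Num.sqrt (\sum_i v i ^+ 2).

Definition edist_set (I : finType) (v : I -> R) (S : set (I -> R)) : \bar R :=
  ereal_inf [set (enorm (fun i => v i - w i))%:E | w in S].

Definition coords n (x : 'cV[R]_n) : 'I_n -> R := fun i => x i 0.

Definition dist_set n (x : 'cV[R]_n) (X : set 'cV[R]_n) : \bar R :=
  edist_set (coords x) (@coords n @` X).

Definition eball n (rho : R) : set 'cV[R]_n :=
  [set x | enorm (coords x) <= rho].

Definition peval n (p : {mpoly R[n]}) (x : 'cV[R]_n) : R := meval (coords x) p.

Definition is_min n (f : {mpoly R[n]}) (X : set 'cV[R]_n) (c : R) : Prop :=
  (exists2 x, X x & peval f x = c) /\ (forall x, X x -> c <= peval f x).

Definition bigO_inv (u : nat -> \bar R) : Prop :=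
  exists C : R, \forall r \near \oo, (`|u r| <= (C / r%:R)%:E)%E.

End Euclidean.

Section Polytope.
Variables (R : realType) (m n : nat).
Variables (A : 'M[R]_(m, n)) (b : 'cV[R]_m) (rho : R).

Definition polytope : set 'cV[R]_n :=
  [set x | forall j, (A *m x) j 0 <= b j 0].

(* [ord0] carries the redundant ball constraint, [lift ord0 j] the j-th row. *)
Definition constraints (i : 'I_m.+1) : {mpoly R[n]} :=
  if unlift ord0 i is Some j
  then mpolyC n (b j 0) - \sum_k A j k *: mpolyX R (mnm1 k)
  else mpolyC n (rho ^+ 2) - \sum_k mpolyX R (mnm1 k) ^+ 2.

End Polytope.

Section Hierarchies.
Variables (R : realType) (n : nat) (I : finType).
Implicit Types (f p q s : {mpoly R[n]}) (g : I -> {mpoly R[n]}) (r k t : nat).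

(* ceil (deg p / 2), with deg 0 = 0 *)
Definition half_deg p : nat := uphalf (msize p).-1.

Definition sos t : set {mpoly R[n]} :=
  [set s | (msize s <= (2 * t).+1)%N /\
           exists qs : seq {mpoly R[n]}, s = \sum_(q <- qs) q ^+ 2].

Definition gprod g (J : {set I}) : {mpoly R[n]} := \prod_(j in J) g j.

Definition truncated_preordering g r : set {mpoly R[n]} :=
  [set p | exists sigma : {set I} -> {mpoly R[n]},
     (forall J, (half_deg (gprod g J) <= r)%N ->
        sos (r - half_deg (gprod g J)) (sigma J)) /\
     p = \sum_(J : {set I} | (half_deg (gprod g J) <= r)%N)
            sigma J * gprod g J].

(* Without equality constraints, the reduced certificate is the truncated
   preordering. *)
Definition reduced_certificate g r : set {mpoly R[n]} :=
  truncated_preordering g r.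

Definition lb f (C : set {mpoly R[n]}) : \bar R :=
  ereal_sup [set a%:E | a in [set a : R | C (f - mpolyC n a)]].

(* Meaningful for polynomials of degree at most [k]; higher coefficients are
   dropped. *)
Definition riesz k (y : exponents n k -> R) f : R :=
  \sum_(a : exponents n k) mcoeff a f * y a.

Definition psd (K : finType) (M : K -> K -> R) : Prop :=
  (forall a b, M a b = M b a) /\
  (forall v : K -> R, 0 <= \sum_a \sum_b v a * M a b * v b).

Definition moment_matrix k (y : exponents n k -> R) p t :
    exponents n t -> exponents n t -> R :=
  fun a b => riesz y (p * mpolyX R (mnm_add a b)).

Definition pseudo_moments g r : set (exponents n (2 * r) -> R) :=
  [set y | [/\ y bm0 = 1,
               psd (moment_matrix y 1 (t := r)) &
               forall J : {set I}, (half_deg (gprod g J) <= r)%N ->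
                 psd (moment_matrix y (gprod g J)
                        (t := r - half_deg (gprod g J)))]].

(* Without equality constraints, the moment relaxations coincide too. *)
Definition reduced_pseudo_moments g r : set (exponents n (2 * r) -> R) :=
  @pseudo_moments g r.

Definition mlb f k (M : set (exponents n k -> R)) : \bar R :=
  ereal_inf [set (riesz y f)%:E | y in M].

(* The value 0 is a dummy, used only if [l < k]. *)
Definition restrict_moments l k (y : exponents n l -> R) : exponents n k -> R :=
  fun a => oapp y 0 (insub (a : multinom n)).

Definition restricted_pseudo_moments g r k : set (exponents n k -> R) :=
  @restrict_moments (2 * r) k @` @pseudo_moments g r.

Definition borel_Rn := g_sigma_algebraType (@open 'cV[R]_n).

Definition moments (X : set 'cV[R]_n) k : set (exponents n k -> R) :=
  [set z | exists nu : probability borel_Rn R,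
     nu X = 1%E /\
     forall a : exponents n k,
       (\int[nu]_(x in X) (peval (mpolyX R a) x)%:E = (z a)%:E)%E].

Definition moment_dist g (X : set 'cV[R]_n) k r : \bar R :=
  ereal_sup [set edist_set y (moments X (k := k)) |
             y in restricted_pseudo_moments g r (k := k)].

End Hierarchies.

Arguments pseudo_moments {R n I} g r _.
Arguments reduced_pseudo_moments {R n I} g r _.
Arguments restricted_pseudo_moments {R n I} g r k _.
Arguments moments {R n} X k _.

(* Main.v *)
(* A pseudo-moment functional is localised by positive polynomial kernels in the
   slack coordinates [u_j = 2 g_j / D - 1], which range over [-1, 1] on the
   polytope: [1 - u_j ^ 2] lies in the preordering, since the ball constraint
   bounds [D - g_j].

   In one variable, squares of Jackson-type trigonometric polynomials give
   weights [w_l], localised at nodes [s_l] with mean square deviation O(1/p^2)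
   and certified nonnegative on [-1, 1] in degree O(p). Products of these weights
   give weights [W_L] in the preordering, of sum 1, indexed by points of a grid of
   the cube of slacks. The grid points have nonnegative coordinates but need not
   be slack vectors of points of R^n; still, by Hoffman's error bound, each of
   them has a point [y_L] of the polytope near it with
   [|x - y_L|^2 <= C |g(x) - s_L|^2] certified by squares, so that
   [sum_L W_L |x - y_L|^2 = O(1/p^2)].

   For [d = 1/p], the inequality
   [f(x) >= f(y_L) - C (d + |x - y_L|^2 / d)] is certified in bounded degree, and
   averaging it with the weights [W_L] yields [f >= min f - O(1/p)]. The constants
   depend only on the degree and on a bound for the coefficients of [f]; by
   separation this uniformity gives the distance between pseudo-moments and
   moments. *)
Require Import Defs.
From HB Require Import structures.
From mathcomp Require Import all_boot all_order all_algebra.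
From mathcomp Require Import all_classical all_reals all_analysis.
From mathcomp Require Import -(notations) mpoly.
From mathcomp Require Import measurable_realfun.
From mathcomp Require Import ring lra zify.

Set Implicit Arguments.
Unset Strict Implicit.
Unset Printing Implicit Defensive.

Import Order.TTheory GRing.Theory Num.Theory.
Import numFieldNormedType.Exports.

Local Open Scope classical_set_scope.
Local Open Scope ring_scope.

(** * Hoffman's error bound *)

Lemma interval_selection (R : realFieldType) (I J : finType) (P : pred I)
    (Q : pred J) (B : I -> R) (G : J -> R) (t D : R) :
  0 <= D -> (forall i j, P i -> Q j -> G j <= B i) ->
  (forall i, P i -> t <= B i + D) -> (forall j, Q j -> G j - D <= t) ->
  exists t', [/\ `|t - t'| <= D, forall i, P i -> t' <= B i
                 & forall j, Q j -> G j <= t'].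
Proof.
move=> D0 GB tB Gt; pose t1 := \big[Num.min/t]_(i | P i) B i.
have t1t : t1 <= t by exact: bigmin_le_id.
have t1B i : P i -> t1 <= B i by move=> Pi; exact: bigmin_le_cond.
have tt1 : t - D <= t1.
  apply/le_bigmin; first by lra.
  by move=> i Pi; have := tB i Pi; lra.
exists (\big[Num.max/t1]_(j | Q j) G j); split.
- have h1 : t1 <= \big[Num.max/t1]_(j | Q j) G j by exact: bigmax_ge_id.
  have h2 : \big[Num.max/t1]_(j | Q j) G j <= t + D.
    apply/bigmax_le; first by lra.
    by move=> j Qj; have := Gt j Qj; lra.
  by rewrite ler_distlC; apply/andP; split; lra.
- move=> i Pi; apply/bigmax_le; first exact: t1B.
  by move=> j Qj; exact: GB.
- by move=> j Qj; exact: le_bigmax_cond.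
Qed.

(* Fourier-Motzkin elimination of the last variable: the rows of the projected
   system combine a row bounding it from above with one bounding it from
   below. *)
Lemma hoffman_bound (R : realFieldType) n : forall (I : finType)
    (a : I -> nat -> R) (b : I -> R),
  (exists y : nat -> R, forall i, \sum_(k < n) a i k * y k <= b i) ->
  exists c : R, 0 <= c /\ forall (x : nat -> R) (e : R), 0 <= e ->
    (forall i, \sum_(k < n) a i k * x k <= b i + e) ->
    exists y : nat -> R, (forall i, \sum_(k < n) a i k * y k <= b i) /\
      forall k, (k < n)%N -> `|x k - y k| <= c * e.
Proof.
elim: n => [|n IH] I a b [y0 y0P].
  exists 0; split=> // x e e0 _; exists x; split=> // i.
  by have := y0P i; rewrite !big_ord0.
pose up i := 0 < a i n; pose dn i := a i n < 0.
pose a' (p : I * I) k := if up p.1 && dn p.2 then a p.1 k / a p.1 n - a p.2 k / a p.2 n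
  else if a p.1 n == 0 then a p.1 k else 0.
pose b' (p : I * I) := if up p.1 && dn p.2 then b p.1 / a p.1 n - b p.2 / a p.2 n
  else if a p.1 n == 0 then b p.1 else 0.
pose s i (u : nat -> R) := \sum_(k < n) a i k * u k.
have s'E p (u : nat -> R) : \sum_(k < n) a' p k * u k =
    if up p.1 && dn p.2 then s p.1 u / a p.1 n - s p.2 u / a p.2 n
    else if a p.1 n == 0 then s p.1 u else 0.
  rewrite /a'; case: ifP => _.
    rewrite /s !mulr_suml -sumrB; apply: eq_bigr => k _; ring.
  case: ifP => _ //; apply: big1 => k _; exact: mul0r.
have sE i (u : nat -> R) : \sum_(k < n.+1) a i k * u k = s i u + a i n * u n.
  by rewrite big_ord_recr.
have upP i u v d : up i -> (s i u + a i n * v <= b i + d) =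
    (v <= (b i - s i u) / a i n + d / a i n).
  by move=> ui; rewrite -mulrDl ler_pdivlMr // mulrC; apply/idP/idP; lra.
have dnP i u v d : dn i -> (s i u + a i n * v <= b i + d) =
    ((b i - s i u) / a i n + d / a i n <= v).
  by move=> ui; rewrite -mulrDl ler_ndivrMr // mulrC; apply/idP/idP; lra.
have [|c' [c'0 c'P]] := IH _ a' b'.
  exists y0 => -[i j]; rewrite s'E /b' /=; case: ifP => [/andP[ui dj]|_].
    have := y0P i; have := y0P j; rewrite !sE.
    rewrite -[b j]addr0 -[b i]addr0 (upP i) // (dnP j) // !mul0r !addr0 !mulrBl => h1 h2.
    by have := le_trans h1 h2; lra.
  case: eqP => // ai0; have := y0P i; by rewrite sE ai0 mul0r addr0.
pose K0 := \sum_i `|(a i n)^-1|.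
have K0P i : `|(a i n)^-1| <= K0.
  by rewrite /K0 (bigD1 i) //= lerDl sumr_ge0.
have K00 : 0 <= K0 by apply: sumr_ge0.
pose K := 1 + 2 * K0.
pose S := \sum_i \sum_(k < n) `|a i k|.
have S0 : 0 <= S by do 2 (apply: sumr_ge0 => ? _).
have K1 : 0 <= K by rewrite /K; lra.
pose c1 := c' * K; have c10 : 0 <= c1 by apply: mulr_ge0.
pose c2 := (1 + S * c1) * K0.
have c20 : 0 <= c2 by rewrite !mulr_ge0 // addr_ge0 // mulr_ge0.
exists (c1 + c2); split; first exact: addr_ge0.
move=> x e e0 xP.
have [||u [uP ux]] := c'P x (K * e); first exact: mulr_ge0.
  move=> [i j]; rewrite s'E /b' /=; case: ifP => [/andP[ui dj]|_].
    have := xP i; have := xP j; rewrite !sE (upP i) // (dnP j) // => h1 h2.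
    have := le_trans h1 h2; rewrite !mulrBl => h.
    have hi : e / a i n <= K0 * e.
      by rewrite mulrC ler_wpM2r // (le_trans (ler_norm _)).
    have hj : - (e / a j n) <= K0 * e.
      by rewrite -mulrN mulrC ler_wpM2r // (le_trans (ler_norm _)) // normrN.
    by rewrite /K; lra.
  have Ke : e <= K * e by rewrite /K; nra.
  case: eqP => // ai0; last by rewrite add0r mulr_ge0.
  have := xP i; rewrite sE ai0 mul0r addr0; lra.
have su i : s i u <= s i x + S * c1 * e.
  rewrite -lerBlDl /s -sumrB.
  have -> : S * c1 * e = \sum_i \sum_(k < n) `|a i k| * (c1 * e).
    rewrite -mulrA /S mulr_suml; apply: eq_bigr => ? _; exact: mulr_suml.
  rewrite (bigD1 i) //=; apply: ler_wpDr.
    by do 2 (apply: sumr_ge0 => ? _); rewrite !mulr_ge0.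
  apply: ler_sum => k _; rewrite -mulrBr (le_trans (ler_norm _)) // normrM.
  by rewrite ler_wpM2l // distrC /c1 -mulrA ux.
have c2e : c2 * e = (1 + S * c1) * e * K0 by rewrite /c2; ring.
have [||||t' [tt' t'up t'dn]] := @interval_selection R I I up dn
  (fun i => (b i - s i u) / a i n) (fun i => (b i - s i u) / a i n) (x n) (c2 * e).
- exact: mulr_ge0.
- move=> i j ui dj; have := uP (i, j); rewrite s'E /b' /= ui dj /= !mulrBl; lra.
- move=> i ui; have := xP i; rewrite sE => h.
  have {}h : s i u + a i n * x n <= b i + (1 + S * c1) * e by have := su i; lra.
  move: h; rewrite upP // => /le_trans; apply; rewrite lerD2l c2e.
  rewrite ler_wpM2l //.
    by rewrite mulr_ge0 // addr_ge0 // mulr_ge0.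
  exact: le_trans (ler_norm _) _.
- move=> i di; have := xP i; rewrite sE => h.
  have {}h : s i u + a i n * x n <= b i + (1 + S * c1) * e by have := su i; lra.
  move: h; rewrite dnP //; apply: le_trans; rewrite lerD2l c2e.
  rewrite lerNl -mulrN ler_wpM2l //.
    by rewrite mulr_ge0 // addr_ge0 // mulr_ge0.
  by rewrite (le_trans (ler_norm _)) // normrN.
pose y k := if k == n then t' else u k.
exists y; split.
  move=> i; rewrite (sE i y) {2}/y eqxx.
  have -> : s i y = s i u.
    by apply: eq_bigr => k _; rewrite /y ltn_eqF.
  rewrite -[b i]addr0; case: (ltrgt0P (a i n)) => [ui|di|ai0].
  - by rewrite upP // mul0r addr0 t'up.
  - by rewrite dnP // mul0r addr0 t'dn.
  - have := uP (i, i); rewrite s'E /b' /up /dn /= ai0 ltxx eqxx /= mul0r !addr0.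
    done.
move=> k; rewrite /y ltnS leq_eqVlt; case: eqP => [->|_ /= kn].
  by move=> _; apply: le_trans tt' _; rewrite ler_wpM2r // lerDr.
by apply: le_trans (ux k kn) _; rewrite mulrA ler_wpM2r // lerDl.
Qed.

(** * Localised positive weights on [-1, 1] *)

Section TrigonometricPolynomials.
Variable R : realType.
Implicit Types (F G : R -> R) (d : nat) (p : {poly R}).

Definition trig_poly d F := exists P Q : {poly R},
  [/\ (size P <= d.+1)%N, (size Q <= d)%N
    & forall th, F th = P.[cos th] + sin th * Q.[cos th]].

Lemma trig_polyC d c : trig_poly d (fun=> c).
Proof.
exists c%:P, 0; split; rewrite ?size_poly0 //.
  exact: leq_trans (size_polyC_leq1 _) _.
by move=> th; rewrite hornerC horner0 mulr0 addr0.
Qed.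

Lemma trig_polyD d F G :
  trig_poly d F -> trig_poly d G -> trig_poly d (fun th => F th + G th).
Proof.
move=> [P [Q [sP sQ FE]]] [P' [Q' [sP' sQ' GE]]]; exists (P + P'), (Q + Q').
split; first by rewrite (leq_trans (size_polyD _ _)) // geq_max sP.
  by rewrite (leq_trans (size_polyD _ _)) // geq_max sQ.
by move=> th; rewrite FE GE !hornerD; ring.
Qed.

Lemma trig_polyZ d c F : trig_poly d F -> trig_poly d (fun th => c * F th).
Proof.
move=> [P [Q [sP sQ FE]]]; exists (c *: P), (c *: Q); split.
- exact: leq_trans (size_scale_leq _ _) sP.
- exact: leq_trans (size_scale_leq _ _) sQ.
- by move=> th; rewrite FE !hornerZ; ring.
Qed.

Lemma trig_poly_leq d d' F : (d <= d')%N -> trig_poly d F -> trig_poly d' F.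
Proof.
move=> dd' [P [Q [sP sQ FE]]]; exists P, Q; split=> //.
  exact: leq_trans sP _.
exact: leq_trans sQ _.
Qed.

Lemma trig_poly_cos d F :
  trig_poly d F -> trig_poly d.+1 (fun th => cos th * F th).
Proof.
move=> [P [Q [sP sQ FE]]]; exists ('X * P), ('X * Q); split.
- by rewrite (leq_trans (size_polyMleq _ _)) // size_polyX.
- by rewrite (leq_trans (size_polyMleq _ _)) // size_polyX.
- by move=> th; rewrite FE !hornerM !hornerX; ring.
Qed.

Lemma trig_poly_sin d F :
  trig_poly d F -> trig_poly d.+1 (fun th => sin th * F th).
Proof.
move=> [P [Q [sP sQ FE]]]; exists ((1 - 'X ^+ 2) * Q), P; split=> //.
- rewrite (leq_trans (size_polyMleq _ _)) //.
  have : (size (1 - 'X^2 : {poly R})%R <= 3)%N.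
    by rewrite (leq_trans (size_polyD _ _)) // size_polyN size_polyXn size_poly1.
  by move: sQ; lia.
- move=> th; rewrite FE hornerM !hornerE.
  by rewrite mulrDr mulrA -expr2 sin2cos2; ring.
Qed.

Lemma trig_poly_cos_sinMn k :
  trig_poly k (fun th => cos (k%:R * th)) /\
  trig_poly k (fun th => sin (k%:R * th)).
Proof.
elim: k => [|k [IHc IHs]].
  split; [have := trig_polyC 0 1 | have := trig_polyC 0 0];
    by congr trig_poly; apply/funext => th; rewrite mul0r ?cos0 ?sin0.
have E th : k.+1%:R * th = k%:R * th + th :> R by rewrite -natr1; ring.
split.
  have := trig_polyD (trig_poly_cos IHc) (trig_polyZ (-1) (trig_poly_sin IHs)).
  by congr trig_poly; apply/funext => th; rewrite E cosD; ring.
have := trig_polyD (trig_poly_sin IHc) (trig_poly_cos IHs).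
by congr trig_poly; apply/funext => th; rewrite E sinD; ring.
Qed.

Lemma trig_poly_sum d n (F : nat -> R -> R) :
  (forall k, (k < n)%N -> trig_poly d (F k)) ->
  trig_poly d (fun th => \sum_(k < n) F k th).
Proof.
elim: n => [|n IH] FP.
  have := trig_polyC d 0; congr trig_poly.
  by apply/funext => th; rewrite big_ord0.
have {IH} := trig_polyD (IH (fun k kn => FP k (ltnW kn))) (FP n (ltnSn n)).
by congr trig_poly; apply/funext => th; rewrite big_ord_recr.
Qed.

Lemma trig_poly_cos_sum n (h : nat -> R) phi :
  trig_poly n (fun th => \sum_(k < n.+1) h k * cos (k%:R * (th - phi))).
Proof.
apply: (@trig_poly_sum n n.+1 (fun k th => h k * cos (k%:R * (th - phi)))) => k kn.
apply: (@trig_polyZ n (h k) (fun th => cos (k%:R * (th - phi)))).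
have [c s] := trig_poly_cos_sinMn k.
apply: (@trig_poly_leq k); first by [].
have := trig_polyD (trig_polyZ (cos (k%:R * phi)) c)
  (trig_polyZ (sin (k%:R * phi)) s).
by congr trig_poly; apply/funext => th; rewrite mulrBr cosB; ring.
Qed.

Lemma trig_poly_sin_sum n (h : nat -> R) phi :
  trig_poly n (fun th => \sum_(k < n.+1) h k * sin (k%:R * (th - phi))).
Proof.
apply: (@trig_poly_sum n n.+1 (fun k th => h k * sin (k%:R * (th - phi)))) => k kn.
apply: (@trig_polyZ n (h k) (fun th => sin (k%:R * (th - phi)))).
have [c s] := trig_poly_cos_sinMn k.
apply: (@trig_poly_leq k); first by [].
have := trig_polyD (trig_polyZ (- sin (k%:R * phi)) c)
  (trig_polyZ (cos (k%:R * phi)) s).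
by congr trig_poly; apply/funext => th; rewrite mulrBr sinB; ring.
Qed.

Definition interval_sos d p := exists2 s : seq ({poly R} * {poly R}),
  all (fun x : {poly R} * {poly R} => (size x.1 <= d.+1)%N && (size x.2 <= d)%N) s &
  p = \sum_(x <- s) (x.1 ^+ 2 + (1 - 'X ^+ 2) * x.2 ^+ 2).

Lemma interval_sosD d p q :
  interval_sos d p -> interval_sos d q -> interval_sos d (p + q).
Proof.
move=> [s sP ->] [t tP ->]; exists (s ++ t); first by rewrite all_cat sP.
by rewrite big_cat.
Qed.

Lemma interval_sos_sum d n (F : 'I_n -> {poly R}) :
  (forall l, interval_sos d (F l)) -> interval_sos d (\sum_l F l).
Proof.
move=> FP; apply: big_ind => //; last exact: interval_sosD.
by exists [::]; rewrite // big_nil.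
Qed.

Lemma interval_sosZ d c p : 0 <= c -> interval_sos d p -> interval_sos d (c *: p).
Proof.
move=> c0 [s sP ->]; pose k := Num.sqrt c.
exists [seq (k *: x.1, k *: x.2) | x <- s].
  apply/allP => _ /mapP[x xs ->] /=; have /andP[h1 h2] := allP sP x xs.
  by rewrite !(leq_trans (size_scale_leq _ _)).
rewrite big_map scaler_sumr; apply: eq_bigr => x _ /=.
by rewrite -(sqr_sqrtr c0) -/k !exprZn scalerDr -scalerAr.
Qed.

Lemma interval_sosC d c : 0 <= c -> interval_sos d c%:P.
Proof.
move=> c0; rewrite -[c%:P]mulr1 mul_polyC; apply: interval_sosZ => //.
exists [:: (1, 0)]; first by rewrite /= size_poly1 size_poly0.
by rewrite big_seq1 /=; ring.
Qed.

Lemma interval_sos_symmetrize d F : trig_poly d F -> exists2 p, interval_sos d p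
  & forall th, p.[cos th] = F th ^+ 2 + F (- th) ^+ 2.
Proof.
move=> [P [Q [sP sQ FE]]].
exists (2 *: (P ^+ 2 + (1 - 'X ^+ 2) * Q ^+ 2)).
  apply: interval_sosZ => //; exists [:: (P, Q)]; first by rewrite /= sP sQ.
  by rewrite big_seq1.
move=> th; rewrite !FE sinN cosN !hornerE /= -sin2cos2; ring.
Qed.

Lemma poly_eq_cos p q : (forall th, p.[cos th] = q.[cos th]) -> p = q.
Proof.
move=> pq; apply/eqP; rewrite -subr_eq0; apply/negPn/negP => pq0.
pose u (k : nat) : R := k.+1%:R^-1.
have := @max_poly_roots _ (p - q) [seq u k | k <- iota 0 (size (p - q)).+1] pq0.
rewrite size_map size_iota ltnNge leqnSn => H; suff: false by []; apply: H.
  apply/allP => _ /mapP[k _ ->]; rewrite /root !hornerE subr_eq0.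
  rewrite -[u k]acosK; first by apply/eqP.
  rewrite in_itv /= /u invf_le1 ?ltr0n // ler1n andbT.
  by rewrite (@le_trans _ _ 0) // ?invr_ge0 // lerN10.
rewrite map_inj_uniq ?iota_uniq // => i j /invr_inj /eqP.
by rewrite eqr_nat => /eqP[].
Qed.

End TrigonometricPolynomials.

Section LocalizedWeights.
Variable R : realType.
Implicit Types (h : nat -> R) (n N : nat).

Lemma sin_natmul_2pi k (x : R) : sin (x + k%:R * (2 * pi)) = sin x.
Proof.
elim: k => [|k IH]; first by rewrite mul0r addr0.
rewrite -{}IH -(sinD2pi (x + k%:R * _)); congr sin.
by rewrite -natr1 -mulr_natl; ring.
Qed.

Lemma sum_cos_equidistant N j k (th : R) : (j < N)%N -> (k < N)%N -> j != k ->
  \sum_(l < N) cos ((j%:R - k%:R) * (th - 2 * pi * l%:R / N%:R)) = 0.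
Proof.
move=> jN kN jk; have N0 : (0 < N)%N by exact: leq_ltn_trans jN.
have N0' : N%:R != 0 :> R by rewrite pnatr_eq0 -lt0n.
pose a : R := j%:R - k%:R; pose x := a * pi / N%:R.
have sin_neq0 i i' : (i < i')%N -> (i' < N)%N ->
    sin ((i'%:R - i%:R) * pi / N%:R : R) != 0.
  move=> ii' i'N; apply: lt0r_neq0; apply: sin_gt0_pi; rewrite -natrB ?(ltnW ii') //.
  rewrite !divr_gt0 ?mulr_gt0 ?pi_gt0 ?ltr0n ?subn_gt0 //=.
  by rewrite ltr_pdivrMr ?ltr0n // mulrC ltr_pM2l ?pi_gt0 // ltr_nat; lia.
have x0 : sin x != 0.
  have /orP[kj|jk'] : (k < j)%N || (j < k)%N by rewrite -neq_ltn eq_sym.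
    exact: sin_neq0.
  by rewrite /x /a -(opprB k%:R j%:R) !mulNr sinN oppr_eq0 sin_neq0.
apply: (mulfI x0); apply: (mulfI (_ : 2 != 0 :> R)); first by rewrite pnatr_eq0.
rewrite !mulr0 !mulr_sumr; pose f (l : nat) : R := sin (a * th + x - 2 * x * l%:R).
transitivity (\sum_(0 <= l < N) (- f l.+1 - - f l)).
  rewrite big_mkord; apply: eq_bigr => l _; rewrite /f.
  have -> : a * th + x - 2 * x * l.+1%:R = a * th - 2 * x * l%:R - x.
    by rewrite -natr1; ring.
  have -> : a * th + x - 2 * x * l%:R = a * th - 2 * x * l%:R + x by ring.
  have -> : a * (th - 2 * pi * l%:R / N%:R) = a * th - 2 * x * l%:R.
    by rewrite /x; field.
  by move: (a * th - _) => y; rewrite sinB sinD; ring.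
rewrite (telescope_sumr (fun l => - f l)) // /f mulr0 subr0 opprK addrC.
have -> : 2 * x * N%:R = 2 * a * pi by rewrite /x; field.
apply/eqP; rewrite subr_eq0; apply/eqP.
rewrite -[LHS](sin_natmul_2pi k) -[RHS](sin_natmul_2pi j).
by congr sin; rewrite /a; ring.
Qed.

Definition fejer h n (psi : R) : R :=
  (\sum_(k < n) h k * cos (k%:R * psi)) ^+ 2 +
  (\sum_(k < n) h k * sin (k%:R * psi)) ^+ 2.

Lemma parseval h n N th : (n <= N)%N ->
  \sum_(l < N) fejer h n (th - 2 * pi * l%:R / N%:R) =
  N%:R * \sum_(k < n) h k ^+ 2.
Proof.
move=> nN.
have E psi : fejer h n psi = \sum_(j < n) \sum_(k < n)
    h j * h k * cos ((j%:R - k%:R) * psi).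
  rewrite /fejer !expr2 !big_distrl /= -big_split /=; apply: eq_bigr => j _.
  rewrite !big_distrr /= -big_split /=; apply: eq_bigr => k _.
  by rewrite mulrBl cosB; ring.
under eq_bigr do rewrite E.
rewrite exchange_big /= mulr_sumr; apply: eq_bigr => j _.
rewrite exchange_big /= (bigD1 j) //= [X in _ + X]big1 ?addr0 => [|k kj]; last first.
  rewrite -mulr_sumr sum_cos_equidistant ?mulr0 //.
  - exact: leq_trans nN.
  - exact: leq_trans nN.
  - by rewrite eq_sym.
under eq_bigr do rewrite subrr mul0r cos0 mulr1.
by rewrite sumr_const card_ord -expr2 mulr_natl.
Qed.

Definition backward_diff h k : R := h k - (if k is j.+1 then h j else 0).

Lemma fejer_backward_diff h n psi : h n = 0 ->
  fejer (backward_diff h) n.+1 psi =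
  fejer h n psi * ((cos psi - 1) ^+ 2 + sin psi ^+ 2).
Proof.
move=> hn0; rewrite /fejer.
have E (F : nat -> R) : \sum_(k < n.+1) backward_diff h k * F k =
    \sum_(k < n) h k * F k - \sum_(k < n) h k * F k.+1.
  under eq_bigr do rewrite mulrBl.
  rewrite sumrB big_ord_recr /= hn0 mul0r addr0; congr (_ - _).
  by rewrite big_ord_recl /= mul0r add0r.
have Ek k : k.+1%:R * psi = k%:R * psi + psi by rewrite -natr1; ring.
have Ec : \sum_(k < n) h k * cos (k.+1%:R * psi) =
    cos psi * (\sum_(k < n) h k * cos (k%:R * psi)) -
    sin psi * (\sum_(k < n) h k * sin (k%:R * psi)).
  rewrite !mulr_sumr -sumrB; apply: eq_bigr => k _; rewrite Ek cosD; ring.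
have Es : \sum_(k < n) h k * sin (k.+1%:R * psi) =
    sin psi * (\sum_(k < n) h k * cos (k%:R * psi)) +
    cos psi * (\sum_(k < n) h k * sin (k%:R * psi)).
  rewrite !mulr_sumr -big_split; apply: eq_bigr => k _; rewrite Ek sinD /=; ring.
rewrite (E (fun k => cos (k%:R * psi))) (E (fun k => sin (k%:R * psi))) Ec Es.
ring.
Qed.

Definition tent p k : R := (minn k (2 * p - k))%:R.

Lemma sum_sqr_tent p : (0 < p)%N -> p%:R ^+ 3 / 3 <= \sum_(k < 2 * p) tent p k ^+ 2.
Proof.
move=> p0.
have cube n : n%:R ^+ 3 / 3 <= \sum_(k < n.+1) (k%:R : R) ^+ 2.
  elim: n => [|n IH]; first by rewrite expr0n mul0r sumr_ge0.
  rewrite big_ord_recr /= -natr1; have n0 : 0 <= n%:R :> R by [].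
  by move: IH n0; move: (n%:R) (\sum_(k < n.+1) _) => x y; nra.
apply: le_trans (cube p) _.
rewrite -(big_mkord xpredT (fun k => tent p k ^+ 2)).
rewrite (@big_cat_nat _ _ _ p.+1) //=; last by lia.
rewrite -[leLHS]addr0 lerD ?sumr_ge0 // => [|i _]; last exact: sqr_ge0.
rewrite big_mkord le_eqVlt; apply/orP; left; apply/eqP; apply: eq_bigr => i _.
by congr (_%:R ^+ 2); have := ltn_ord i; lia.
Qed.

Lemma sum_sqr_diff_tent p : (0 < p)%N ->
  \sum_(k < (2 * p).+1) backward_diff (tent p) k ^+ 2 <= 3 * p%:R.
Proof.
move=> p0; apply: (@le_trans _ _ (\sum_(k < (2 * p).+1) (1 : R))).
  apply: ler_sum => -[[|k] kp] _; rewrite /backward_diff /tent /=.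
    by rewrite min0n subr0 expr0n ler01.
  have [kp'|kp'] := leqP k.+1 p.
    have -> : minn k.+1 (2 * p - k.+1) = (minn k (2 * p - k)).+1 by lia.
    by rewrite -natr1 addrAC subrr add0r expr1n.
  have -> : minn k (2 * p - k) = (minn k.+1 (2 * p - k.+1)).+1 by lia.
  by rewrite -[_.+1%:R]natr1 opprD addrA subrr add0r sqrrN expr1n.
by rewrite sumr_const card_ord -natrM ler_nat; lia.
Qed.

(* [w l] is the Jackson-type kernel centred at the Chebyshev-like node [s l]
   and made even in [th], with ['X = cos th]. Multiplying the kernel by
   [|e^(i th) - e^(i phi)|^2] amounts to differencing its coefficients, so
   the discrete Parseval identity computes both sums exactly, and [v] collects
   the squares [(sin th - sin phi)^2]. *)
Lemma localized_weights p : (0 < p)%N ->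
  exists N (s : 'I_N -> R) (w : 'I_N -> {poly R}) (v : {poly R}),
  [/\ forall l, -1 <= s l <= 1, forall l, interval_sos (2 * p) (w l),
      interval_sos (2 * p) v, \sum_l w l = 1 &
      \sum_l ((s l)%:P - 'X) ^+ 2 * w l = (9 / p%:R ^+ 2)%:P - v].
Proof.
move=> p0; pose n := (2 * p)%N; pose N := n.+1; pose h := tent p.
pose phi (l : 'I_N) : R := 2 * pi * l%:R / N%:R.
pose H := \sum_(k < n) h k ^+ 2.
pose H' := \sum_(k < n.+1) backward_diff h k ^+ 2.
have pR : 0 < p%:R :> R by rewrite ltr0n.
have H0 : 0 < H by apply: lt_le_trans (sum_sqr_tent p0); rewrite divr_gt0 ?exprn_gt0.
have N0 : 0 < N%:R :> R by rewrite ltr0n.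
pose c := (2 * N%:R * H)^-1; have c0 : 0 <= c by rewrite invr_ge0 !mulr_ge0 // ltW.
have [n' nE] : exists n', n = n'.+1 by exists n.-1; rewrite /n; lia.
have n'n : (n' <= 2 * p)%N by rewrite -/n nE.
have W l : exists2 w : {poly R}, interval_sos (2 * p) w & forall th,
    w.[cos th] = c * (fejer h n (th - phi l) + fejer h n (- th - phi l)).
  have tc := trig_poly_leq n'n (trig_poly_cos_sum n' h (phi l)).
  have ts := trig_poly_leq n'n (trig_poly_sin_sum n' h (phi l)).
  have [p1 p1P p1E] := interval_sos_symmetrize tc.
  have [p2 p2P p2E] := interval_sos_symmetrize ts.
  exists (c *: (p1 + p2)); first exact/interval_sosZ/interval_sosD.
  by move=> th; rewrite hornerZ hornerD p1E p2E /fejer nE; ring.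
have V l : exists2 v : {poly R}, interval_sos (2 * p) v & forall th, v.[cos th] =
    c * (fejer h n (th - phi l) * (sin th - sin (phi l)) ^+ 2 +
         fejer h n (- th - phi l) * (- sin th - sin (phi l)) ^+ 2).
  have mulsin F : trig_poly n' F -> trig_poly (2 * p)
      (fun th => (sin th - sin (phi l)) * F th).
    move=> Ft; rewrite -/n nE.
    have := trig_polyD (trig_poly_sin Ft)
      (trig_poly_leq (leqnSn n') (trig_polyZ (- sin (phi l)) Ft)).
    by congr trig_poly; apply/funext => th; rewrite mulrDl.
  have [p1 p1P p1E] := interval_sos_symmetrize
    (mulsin _ (trig_poly_cos_sum n' h (phi l))).
  have [p2 p2P p2E] := interval_sos_symmetrize
    (mulsin _ (trig_poly_sin_sum n' h (phi l))).
  exists (c *: (p1 + p2)); first exact/interval_sosZ/interval_sosD.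
  by move=> th; rewrite hornerZ hornerD p1E p2E /fejer nE sinN; ring.
pose w l := projT1 (cid2 (W l)); pose v l := projT1 (cid2 (V l)).
have wP l : interval_sos (2 * p) (w l) by rewrite /w; case: cid2.
have vP l : interval_sos (2 * p) (v l) by rewrite /v; case: cid2.
have wE l th : (w l).[cos th] =
    c * (fejer h n (th - phi l) + fejer h n (- th - phi l)).
  by rewrite /w; case: cid2.
have vE l th : (v l).[cos th] =
    c * (fejer h n (th - phi l) * (sin th - sin (phi l)) ^+ 2 +
         fejer h n (- th - phi l) * (- sin th - sin (phi l)) ^+ 2).
  by rewrite /v; case: cid2.
have chord th ph : fejer h n (th - ph) *
    ((cos th - cos ph) ^+ 2 + (sin th - sin ph) ^+ 2) =
    fejer (backward_diff h) n.+1 (th - ph).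
  rewrite fejer_backward_diff; last by rewrite /h /tent /n subnn minn0.
  congr (_ * _); rewrite sinB cosB.
  have := cos2Dsin2 th; have := cos2Dsin2 ph.
  move: (cos th) (sin th) (cos ph) (sin ph) => ct st cp sp hp ht.
  transitivity ((ct ^+ 2 + st ^+ 2) + (cp ^+ 2 + sp ^+ 2)
    - 2 * (ct * cp + st * sp)); first ring.
  transitivity ((ct ^+ 2 + st ^+ 2) * (cp ^+ 2 + sp ^+ 2) + 1
    - 2 * (ct * cp + st * sp)); last ring.
  by rewrite hp ht mulr1.
have cE (x : R) : c * (N%:R * x + N%:R * x) = x / H.
  by rewrite /c; field; rewrite !gt_eqF.
have H'H : H' / H <= 9 / p%:R ^+ 2.
  rewrite ler_pdivrMr //; apply: le_trans (sum_sqr_diff_tent p0) _.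
  have := sum_sqr_tent p0; rewrite -/H => HP.
  apply: (@le_trans _ _ (9 / p%:R ^+ 2 * (p%:R ^+ 3 / 3))).
    by rewrite le_eqVlt; apply/orP; left; apply/eqP; field; rewrite gt_eqF.
  by rewrite ler_wpM2l // divr_ge0 // exprn_ge0.
exists N, (fun l => cos (phi l)), w, (\sum_l v l + (9 / p%:R ^+ 2 - H' / H)%:P).
split=> //.
- by move=> l; rewrite cos_geN1 cos_le1.
- apply: interval_sosD; first exact: interval_sos_sum.
  by apply: interval_sosC; rewrite subr_ge0.
- apply: poly_eq_cos => th; rewrite horner_sum.
  under eq_bigr do rewrite wE.
  rewrite -mulr_sumr big_split /= !parseval // -/H cE divff ?gt_eqF //.
  by rewrite hornerC.
- apply: poly_eq_cos => th; apply/eqP; rewrite -subr_eq0; apply/eqP.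
  rewrite horner_sum hornerD hornerN hornerD !hornerC horner_sum.
  set A := \sum_i _; set B := \sum_i _.
  suff AB : A + B = H' / H by rewrite -AB; ring.
  rewrite /A /B -big_split /=.
  transitivity (\sum_l c * (fejer (backward_diff h) n.+1 (th - phi l) +
                            fejer (backward_diff h) n.+1 (- th - phi l))).
    apply: eq_bigr => l _; rewrite -!chord sinN cosN hornerM wE vE.
    rewrite horner_exp hornerD hornerN hornerC hornerX; ring.
  by rewrite -mulr_sumr big_split /= !parseval // cE.
Qed.

End LocalizedWeights.

(** * Truncated cone of a family of polynomials *)

Section Cone.
Variables (R : realType) (n : nat) (I : finType) (g : I -> {mpoly R[n]}).
Implicit Types (p q : {mpoly R[n]}) (J K : {set I}) (N r : nat).

Definition mdegree p : nat := (msize p).-1.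

Definition weight J : nat := \sum_(j in J) mdegree (g j).

Lemma mdegreeM p q : (mdegree (p * q)%R <= mdegree p + mdegree q)%N.
Proof.
rewrite /mdegree; have [->|p0] := eqVneq p 0; first by rewrite mul0r msize0.
have [->|q0] := eqVneq q 0; first by rewrite mulr0 msize0.
rewrite msizeM //; move: (mmeasure _ p) (mmeasure _ q) => a b; lia.
Qed.

Lemma mdegree_gprod J : (mdegree (gprod g J) <= weight J)%N.
Proof.
rewrite /gprod /weight; elim/big_rec2: _ => [|j y1 y2 _ h].
  by rewrite /mdegree msize1.
by rewrite (leq_trans (mdegreeM _ _)) // leq_add2l.
Qed.

Definition symdiff J K := (J :\: K) :|: (K :\: J).

Lemma big_symdiff (T : Type) (idx : T) (op : Monoid.com_law idx) (F : I -> T) J K :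
  \big[op/idx]_(i in symdiff J K) F i =
  op (\big[op/idx]_(i in J :\: K) F i) (\big[op/idx]_(i in K :\: J) F i).
Proof.
rewrite (big_setID J); congr (op _ _); apply: eq_bigl => i; rewrite !inE;
  by case: (i \in J); case: (i \in K).
Qed.

Lemma gprod_symdiff J K :
  gprod g J * gprod g K = gprod g (J :&: K) ^+ 2 * gprod g (symdiff J K).
Proof.
rewrite /gprod big_symdiff.
rewrite [\prod_(j in J) _](big_setID K) /= [\prod_(j in K) _](big_setID J) /=.
by rewrite [K :&: J]finset.setIC; ring.
Qed.

Lemma weight_symdiff J K :
  (weight J + weight K = 2 * weight (J :&: K) + weight (symdiff J K))%N.
Proof.
rewrite /weight big_symdiff.
rewrite [\sum_(j in J) _](big_setID K) /= [\sum_(j in K) _](big_setID J) /=.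
by rewrite [K :&: J]finset.setIC addnACA mul2n -addnn.
Qed.

Definition cone N p := exists2 s : seq ({mpoly R[n]} * {set I}),
  all (fun x : {mpoly R[n]} * {set I} =>
    (2 * mdegree x.1 + weight x.2 <= N)%N) s &
  p = \sum_(x <- s) x.1 ^+ 2 * gprod g x.2.

Lemma cone_leq N N' p : (N <= N')%N -> cone N p -> cone N' p.
Proof.
move=> NN' [s sP ->]; exists s => //; apply: sub_all sP => x /= h.
exact: leq_trans NN'.
Qed.

Lemma coneD N p q : cone N p -> cone N q -> cone N (p + q).
Proof.
move=> [s sP ->] [t tP ->]; exists (s ++ t); first by rewrite all_cat sP.
by rewrite big_cat.
Qed.

Lemma cone0 N : cone N 0.
Proof. by exists [::]; rewrite ?big_nil. Qed.

Lemma cone_sum N (T : Type) (s : seq T) (P : pred T) (F : T -> {mpoly R[n]}) :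
  (forall i, P i -> cone N (F i)) -> cone N (\sum_(i <- s | P i) F i).
Proof. by move=> FP; apply: big_ind => //; [exact: cone0|exact: coneD]. Qed.

Lemma cone_sqr N p : (2 * mdegree p <= N)%N -> cone N (p ^+ 2).
Proof.
move=> pN; exists [:: (p, finset.set0)]; last by rewrite big_seq1 /gprod big_set0 mulr1.
by rewrite /= /weight big_set0 addn0 pN.
Qed.

Lemma cone_gen i : cone (mdegree (g i)) (g i).
Proof.
exists [:: (1, finset.set1 i)]; last by rewrite big_seq1 /gprod big_set1 expr1n mul1r.
by rewrite /= /weight big_set1 {1}/mdegree msize1 muln0 add0n leqnn.
Qed.

Lemma coneM N N' p q : cone N p -> cone N' q -> cone (N + N') (p * q).
Proof.
have deg (a b : {mpoly R[n]}) J K : (2 * mdegree a + weight J <= N)%N ->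
    (2 * mdegree b + weight K <= N')%N ->
    (2 * mdegree (a * b * gprod g (J :&: K))%R + weight (symdiff J K) <= N + N')%N.
  have := mdegreeM (a * b) (gprod g (J :&: K)).
  have := mdegreeM a b; have := mdegree_gprod (J :&: K).
  by have := weight_symdiff J K; lia.
move=> [s sP ->] [t tP ->].
exists [seq (x.1 * y.1 * gprod g (x.2 :&: y.2), symdiff x.2 y.2) | x <- s, y <- t].
  apply/allP => _ /allpairsP[[x y] /= [xs yt ->]] /=.
  exact: deg (allP sP x xs) (allP tP y yt).
rewrite big_allpairs_dep mulr_suml; apply: eq_bigr => x _; rewrite mulr_sumr.
apply: eq_bigr => y _ /=.
by rewrite mulrACA gprod_symdiff; ring.
Qed.

Lemma coneC N (c : R) : 0 <= c -> cone N (mpolyC n c).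
Proof.
move=> c0; rewrite -(sqr_sqrtr c0) rmorphXn; apply: cone_sqr.
by rewrite /mdegree mmeasureC; case: (_ == _).
Qed.

Lemma coneZ N (c : R) p : 0 <= c -> cone N p -> cone N (c *: p).
Proof.
by move=> c0 pN; rewrite -mul_mpolyC -[N]add0n; apply: coneM => //; apply: coneC.
Qed.

Lemma cone_prod (T : finType) N (F : T -> {mpoly R[n]}) :
  (forall i, cone N (F i)) -> cone (#|T| * N) (\prod_i F i).
Proof.
move=> FP; rewrite -sum_nat_const; elim/big_rec2: _ => [|i p N' _ h].
  by have := coneC 0 (@ler01 R); rewrite mpolyC1.
exact: coneM.
Qed.

Lemma half_deg_gprod r p J : (2 * mdegree p + weight J <= 2 * r)%N ->
  (mdegree p + half_deg (gprod g J) <= r)%N.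
Proof.
have := mdegree_gprod J; rewrite /half_deg -/(mdegree (gprod g J)).
by move: (mdegree _) (mdegree _) (weight _) => a b c; lia.
Qed.

Lemma cone_preordering r p : cone (2 * r) p -> truncated_preordering g r p.
Proof.
move=> [s sP ->].
have sr x : x \in s -> (mdegree x.1 + half_deg (gprod g x.2) <= r)%N.
  by move=> xs; exact: half_deg_gprod (allP sP x xs).
exists (fun J => \sum_(x <- s | x.2 == J) x.1 ^+ 2); split.
  move=> J Jr; split; last first.
    exists [seq x.1 | x <- s & x.2 == J].
    by rewrite big_map big_filter.
  rewrite big_seq_cond.
  apply: (big_ind (fun q => (msize q <= (2 * (r - half_deg (gprod g J))).+1)%N)).
  - by rewrite msize0.
  - by move=> a b ha hb; rewrite (leq_trans (mmeasureD_le _ _ _)) // geq_max ha.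
  - move=> x /andP[/sr xr /eqP xJ]; rewrite expr2; have := mdegreeM x.1 x.1.
    move: xr; rewrite xJ /mdegree.
    move: (mmeasure _ _) (mmeasure _ _) (half_deg _) => a b c; lia.
rewrite [RHS](bigID xpredT) /= [X in _ = _ + X]big_pred0 ?addr0; last first.
  by move=> J; rewrite andbF.
under [RHS]eq_bigr do rewrite mulr_suml.
rewrite (exchange_big_dep xpredT) //= !big_seq; apply: eq_bigr => x xs.
rewrite (bigD1 x.2) /=; last first.
  by rewrite eqxx !andbT (leq_trans (leq_addl _ _) (sr x xs)).
rewrite big1 ?addr0 // => J /andP[/andP[_ /eqP ->]]; by rewrite eqxx.
Qed.

Lemma gprod_ge0 J (x : 'cV[R]_n) : (forall i, 0 <= peval (g i) x) ->
  0 <= peval (gprod g J) x.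
Proof. by move=> gx; rewrite /peval /gprod rmorph_prod prodr_ge0 // => i _; exact: gx. Qed.

Lemma preordering_ge0 r p (x : 'cV[R]_n) : (forall i, 0 <= peval (g i) x) ->
  truncated_preordering g r p -> 0 <= peval p x.
Proof.
move=> gx [sigma [sP ->]]; rewrite /peval raddf_sum sumr_ge0 // => J /sP[_ [qs ->]].
rewrite /= mevalM mulr_ge0 //; last exact: gprod_ge0.
by rewrite raddf_sum sumr_ge0 // => q _; rewrite /= expr2 mevalM -expr2 sqr_ge0.
Qed.

End Cone.

Arguments mdegree {R n} p%_R.

Section Riesz.
Variables (R : realType) (n k : nat) (y : exponents n k -> R).
Implicit Types p q : {mpoly R[n]}.

Lemma rieszD p q : riesz y (p + q) = riesz y p + riesz y q.
Proof. by rewrite /riesz -big_split; apply: eq_bigr => a _; rewrite mcoeffD mulrDl. Qed.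

Lemma rieszZ c p : riesz y (c *: p) = c * riesz y p.
Proof. by rewrite /riesz mulr_sumr; apply: eq_bigr => a _; rewrite mcoeffZ mulrA. Qed.

Lemma riesz0 : riesz y 0 = 0.
Proof. by rewrite /riesz big1 // => a _; rewrite mcoeff0 mul0r. Qed.

Lemma riesz_sum (T : Type) (s : seq T) (P : pred T) (F : T -> {mpoly R[n]}) :
  riesz y (\sum_(i <- s | P i) F i) = \sum_(i <- s | P i) riesz y (F i).
Proof. exact: (big_morph (riesz y) rieszD riesz0). Qed.

Lemma rieszC c : riesz y (mpolyC n c) = c * y bm0.
Proof.
rewrite /riesz (bigD1 bm0) //= mcoeffC eqxx mulr1 big1 ?addr0 // => a.
by rewrite -val_eqE mcoeffC eq_sym => /negbTE /= ->; rewrite mulr0 mul0r.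
Qed.

Lemma riesz_moment_matrix t p q : (msize q <= t.+1)%N ->
  \sum_(a : exponents n t) \sum_(b : exponents n t)
    mcoeff a q * moment_matrix y p a b * mcoeff b q = riesz y (q ^+ 2 * p).
Proof.
move=> qt; rewrite {3}(mpolywE qt) expr2 !mulr_suml riesz_sum.
apply: eq_bigr => a _; rewrite mulr_sumr mulr_suml riesz_sum.
apply: eq_bigr => b _; rewrite /moment_matrix mpolyXD.
rewrite mulrAC -rieszZ; congr (riesz y _).
by rewrite -!scalerAl -!scalerAr -!scalerAl scalerA [p * _]mulrC.
Qed.

End Riesz.

Section Duality.
Variables (R : realType) (n : nat) (I : finType) (g : I -> {mpoly R[n]}).
Implicit Types (p q : {mpoly R[n]}) (r k : nat).

Lemma cone_riesz r y p : pseudo_moments g r y -> cone g (2 * r) p ->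
  0 <= riesz y p.
Proof.
move=> [_ _ yP] [s sP ->]; rewrite riesz_sum big_seq sumr_ge0 // => x xs.
have h := half_deg_gprod (allP sP x xs).
rewrite -(@riesz_moment_matrix _ _ _ _ (r - half_deg (gprod g x.2))).
  by have [_] := yP x.2 (leq_trans (leq_addl _ _) h); exact.
move: h; rewrite /mdegree; move: (mmeasure _ _) (half_deg _) => a b; lia.
Qed.

Definition dirac_moments k (x : 'cV[R]_n) : exponents n k -> R :=
  fun a => peval (mpolyX R a) x.

Lemma riesz_dirac k x p : (msize p <= k.+1)%N ->
  riesz (dirac_moments (k := k) x) p = peval p x.
Proof.
move=> pk; rewrite {2}(mpolywE pk) /peval raddf_sum /=.
by apply: eq_bigr => a _; rewrite mevalZ.
Qed.

Lemma dirac_pseudo_moments r x : (forall i, 0 <= peval (g i) x) ->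
  pseudo_moments g r (dirac_moments x).
Proof.
move=> gx.
have E p t (a b : exponents n t) : (mdegree p + 2 * t <= 2 * r)%N ->
    moment_matrix (dirac_moments (k := 2 * r) x) p a b =
    peval p x * (peval (mpolyX R a) x * peval (mpolyX R b) x).
  move=> pt; rewrite /moment_matrix riesz_dirac.
    by rewrite /peval mevalM mpolyXD mevalM.
  have := mdegreeM p (mpolyX R (mnm_add a b)); rewrite /mdegree msizeX /= mdegD.
  by have := bmdeg a; have := bmdeg b; move: pt; rewrite /mdegree; lia.
have sumsq (K : finType) (c : R) (u : K -> R) :
    \sum_a \sum_b c * (u a * u b) = c * (\sum_a u a) ^+ 2.
  rewrite expr2 big_distrl mulr_sumr; apply: eq_bigr => a _.
  by rewrite /= big_distrr mulr_sumr.
have psdP p t : 0 <= peval p x -> (mdegree p + 2 * t <= 2 * r)%N ->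
    psd (moment_matrix (dirac_moments (k := 2 * r) x) p (t := t)).
  move=> p0 pt; split=> [a b|v]; first by rewrite !E // [peval (mpolyX R a) x * _]mulrC.
  have -> : \sum_a \sum_b v a * moment_matrix (dirac_moments (k := 2 * r) x) p a b * v b
      = peval p x * (\sum_a v a * peval (mpolyX R (bmnm a)) x) ^+ 2.
    rewrite -sumsq; apply: eq_bigr => a _; apply: eq_bigr => b _.
    by rewrite E //; ring.
  by rewrite mulr_ge0 ?sqr_ge0.
split.
- by rewrite /dirac_moments /= mpolyX0 /peval meval1.
- by apply: psdP; rewrite ?/peval ?meval1 // /mdegree msize1.
- move=> J Jr; apply: psdP; first exact: gprod_ge0.
  move: Jr; rewrite /half_deg -/(mdegree (gprod g J)).
  by move: (mdegree _) => d; lia.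
Qed.

End Duality.

(** * Certificates on a polytope *)

Lemma coord_le_enorm (R : realType) (I : finType) (v : I -> R) i : `|v i| <= enorm v.
Proof.
rewrite -sqrtr_sqr /enorm ler_wsqrtr // (bigD1 i) //= lerDl sumr_ge0 // => j _.
exact: sqr_ge0.
Qed.

Lemma lagrange_identity (S : comPzRingType) (I : finType) (a u : I -> S) :
  \sum_i \sum_j (a i * u j - a j * u i) ^+ 2 =
  2 * ((\sum_i a i ^+ 2) * (\sum_i u i ^+ 2) - (\sum_i a i * u i) ^+ 2).
Proof.
have E (F G : I -> S) : (\sum_i F i) * (\sum_i G i) = \sum_i \sum_j F i * G j.
  by rewrite big_distrl; apply: eq_bigr => i _; rewrite /= big_distrr.
transitivity (\sum_i \sum_j (a i ^+ 2 * u j ^+ 2 + a j ^+ 2 * u i ^+ 2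
    - 2 * (a i * u i * (a j * u j)))).
  by apply: eq_bigr => i _; apply: eq_bigr => j _; ring.
under eq_bigr do rewrite sumrB big_split /= -[X in _ - X]mulr_sumr.
rewrite sumrB big_split /= -[X in _ - X]mulr_sumr [X in _ + X - _]exchange_big /=.
by rewrite [(\sum_i _ * _) ^+ 2]expr2 !E; ring.
Qed.

Lemma sum_prod_marginal (S : comPzSemiRingType) (I J : finType) (w : I -> J -> S)
    (h : J -> S) i0 : (forall i, \sum_j w i j = 1) ->
  \sum_(L : {ffun I -> J}) (\prod_i w i (L i)) * h (L i0) = \sum_j w i0 j * h j.
Proof.
move=> w1; pose F i j := if i == i0 then w i j * h j else w i j.
transitivity (\sum_(L : {ffun I -> J}) \prod_i F i (L i)).
  apply: eq_bigr => L _; rewrite (bigD1 i0) // [in RHS](bigD1 i0) //= /F eqxx.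
  rewrite mulrAC; congr (_ * _); apply: eq_bigr => i /negbTE ii0; by rewrite ii0.
rewrite -bigA_distr_bigA (bigD1 i0) //= [X in _ * X]big1 ?mulr1.
  by apply: eq_bigr => j _; rewrite /F eqxx.
by move=> i /negbTE ii0; rewrite -(w1 i); apply: eq_bigr => j _; rewrite /F ii0.
Qed.

Section HoffmanPolytope.
Variables (R : realType) (m n : nat) (A : 'M[R]_(m, n)) (b : 'cV[R]_m).
Local Notation X := (polytope A b).

Lemma polytope_error_bound : X !=set0 -> exists c : R, 0 <= c /\
  forall (x : 'cV[R]_n) (e : R), 0 <= e -> (forall j, (A *m x) j 0 <= b j 0 + e) ->
  exists2 y, X y & forall k, `|x k 0 - y k 0| <= c * e.
Proof.
pose ext (F : 'I_n -> R) (k : nat) := oapp F 0 (insub k).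
have extE F (k : 'I_n) : ext F k = F k by rewrite /ext valK.
have sumE j (x : 'cV[R]_n) : \sum_(k < n) ext (A j) k * ext (fun k => x k 0) k = (A *m x) j 0.
  by rewrite mxE; apply: eq_bigr => k _; rewrite !extE.
move=> [y0 Xy0].
have [|c [c0 cP]] := @hoffman_bound R n 'I_m (fun j => ext (A j)) (fun j => b j 0).
  by exists (ext (fun k => y0 k 0)) => j; rewrite sumE Xy0.
exists c; split=> // x e e0 xP.
have [|y [yP xy]] := cP (ext (fun k => x k 0)) e e0; first by move=> j; rewrite sumE.
exists (\col_k y k).
  move=> j; rewrite mxE (le_trans _ (yP j)) // le_eqVlt; apply/orP; left; apply/eqP.
  by apply: eq_bigr => k _; rewrite extE mxE.
by move=> k; rewrite mxE; have := xy k (ltn_ord k); rewrite extE.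
Qed.

Lemma bounded_polytope_row_full rho : X !=set0 -> X `<=` eball rho -> row_full A.
Proof.
move=> [x Xx] Xball; rewrite -cokermx_eq0; apply/negPn/negP => /eqP C0.
apply: C0; apply/matrixP => i j; rewrite [RHS]mxE; apply/eqP/negPn/negP => Cij.
pose v := col j (cokermx A); pose t := (rho + 1 - x i 0) / v i 0.
have vi : v i 0 != 0 by rewrite mxE.
have Av : A *m v = 0 by rewrite -[v]/(col j _) colE mulmxA mulmx_coker mul0mx.
have Xy : X (x + t *: v).
  by move=> l; rewrite mulmxDr -scalemxAr Av scaler0 addr0; exact: Xx.
have := le_trans (ler_norm _) (le_trans (coord_le_enorm (coords (x + t *: v)) i) (Xball _ Xy)).
rewrite /coords mxE [(t *: v) i 0]mxE /t mulfVK //; lra.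
Qed.

End HoffmanPolytope.

Section Peval.
Variables (R : realType) (n : nat) (x : 'cV[R]_n).
Implicit Types p q : {mpoly R[n]}.

Lemma pevalB p q : peval (p - q) x = peval p x - peval q x.
Proof. exact: mevalB. Qed.

Lemma pevalM p q : peval (p * q) x = peval p x * peval q x.
Proof. exact: mevalM. Qed.

Lemma pevalC c : peval (mpolyC n c) x = c.
Proof. exact: mevalC. Qed.

Lemma pevalZ c p : peval (c *: p) x = c * peval p x.
Proof. exact: mevalZ. Qed.

Lemma pevalXU k : peval (mpolyX R (mnm1 k)) x = x k 0.
Proof. exact: mevalXU. Qed.

Lemma pevalXn p k : peval (p ^+ k) x = peval p x ^+ k.
Proof. exact: (rmorphXn (meval (coords x))). Qed.

Lemma peval_sum (T : Type) (s : seq T) (P : pred T) (F : T -> {mpoly R[n]}) :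
  peval (\sum_(i <- s | P i) F i) x = \sum_(i <- s | P i) peval (F i) x.
Proof. exact: (raddf_sum (meval (coords x))). Qed.

End Peval.

Section PolytopeCertificates.
Variables (R : realType) (m n : nat) (A : 'M[R]_(m, n)) (b : 'cV[R]_m) (rho : R).
Hypothesis X_ball : polytope A b `<=` eball rho.
Hypothesis rho_ge1 : 1 <= rho.
Local Notation X := (polytope A b).
Local Notation g := (constraints A b rho).
Local Notation "c %:C" := (mpolyC n c) (at level 1, format "c %:C").
Local Notation Xv k := (mpolyX R (@mnm1 n k)).
Implicit Types (f p q : {mpoly R[n]}) (x y : 'cV[R]_n).

Lemma constraints_ord0 : g ord0 = (rho ^+ 2)%:C - \sum_k Xv k ^+ 2.
Proof. by rewrite /constraints unlift_none. Qed.

Lemma constraints_lift j :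
  g (lift ord0 j) = (b j 0)%:C - \sum_k A j k *: Xv k.
Proof. by rewrite /constraints liftK. Qed.

Lemma peval_constraints_lift j x : peval (g (lift ord0 j)) x = b j 0 - (A *m x) j 0.
Proof.
rewrite constraints_lift pevalB pevalC peval_sum mxE; congr (_ - _).
by apply: eq_bigr => k _; rewrite pevalZ pevalXU.
Qed.

Lemma constraints_ge0 x : X x -> forall i, 0 <= peval (g i) x.
Proof.
move=> Xx i; case: (unliftP ord0 i) => [j ->|->].
  by rewrite peval_constraints_lift subr_ge0 Xx.
rewrite constraints_ord0 pevalB pevalC peval_sum subr_ge0 /=.
have := X_ball Xx; rewrite /eball /enorm /= => h.
have rho0 : 0 <= rho by exact: le_trans rho_ge1.
rewrite -(@ler_sqr _ _ rho) ?nnegrE ?sqrtr_ge0 // sqr_sqrtr in h; last first.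
  by rewrite sumr_ge0 // => k _; rewrite sqr_ge0.
apply: le_trans h; rewrite le_eqVlt; apply/orP; left; apply/eqP.
by apply: eq_bigr => k _; rewrite pevalXn pevalXU.
Qed.

Lemma cone_ge0 N p x : X x -> cone g N p -> 0 <= peval p x.
Proof.
move=> Xx pN; apply: (preordering_ge0 (r := N) (constraints_ge0 Xx)).
by apply: cone_preordering; apply: cone_leq pN; rewrite leq_pmull.
Qed.

Lemma mdegree_sum N (T : Type) (s : seq T) (F : T -> {mpoly R[n]}) :
  (forall i, (mdegree (F i) <= N)%N) -> (mdegree (\sum_(i <- s) F i) <= N)%N.
Proof.
move=> FN; apply: (big_ind (fun p => (mdegree p <= N)%N)) => //.
  by rewrite /mdegree msize0.
move=> p q; rewrite /mdegree; have := mmeasureD_le (@mdeg n) p q.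
by move: (mmeasure _ _) (mmeasure _ _) (mmeasure _ _) => ? ? ?; lia.
Qed.

Lemma mdegreeC (c : R) : mdegree c%:C = 0%N.
Proof. by rewrite /mdegree mmeasureC; case: (_ == _). Qed.

Lemma mdegreeD N p q : (mdegree p <= N)%N -> (mdegree q <= N)%N ->
  (mdegree (p + q)%R <= N)%N.
Proof.
rewrite /mdegree; have := mmeasureD_le (@mdeg n) p q.
by move: (mmeasure _ _) (mmeasure _ _) (mmeasure _ _) => ? ? ?; lia.
Qed.

Lemma mdegreeN p : mdegree (- p) = mdegree p.
Proof. by rewrite /mdegree mmeasureN. Qed.

Lemma mdegreeZ (c : R) p : (mdegree (c *: p) <= mdegree p)%N.
Proof. by have := mdegreeM c%:C p; rewrite mul_mpolyC mdegreeC. Qed.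

Lemma mdegree_Xv k : mdegree (Xv k) = 1%N.
Proof. by rewrite /mdegree msizeX mdeg1. Qed.

Lemma cone_ball : cone g 2 ((rho ^+ 2)%:C - \sum_k Xv k ^+ 2).
Proof.
rewrite -constraints_ord0; apply: cone_leq (cone_gen g ord0).
rewrite constraints_ord0 mdegreeD ?mdegreeC // mdegreeN mdegree_sum // => k.
by rewrite expr2 (leq_trans (mdegreeM _ _)) // mdegree_Xv.
Qed.

Lemma mdegree_constraints_lift j : (mdegree (g (lift ord0 j)) <= 1)%N.
Proof.
rewrite constraints_lift mdegreeD ?mdegreeC // mdegreeN mdegree_sum // => k.
by rewrite (leq_trans (mdegreeZ _ _)) // mdegree_Xv.
Qed.

Lemma cone_lift j : cone g 1 (g (lift ord0 j)).
Proof. exact: cone_leq (mdegree_constraints_lift j) (cone_gen g _). Qed.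

Lemma cone_sqr_linear p : (mdegree p <= 1)%N -> cone g 2 (p ^+ 2).
Proof. by move=> p1; apply: cone_sqr; rewrite -[leqRHS]muln1 leq_mul2l. Qed.

Lemma mdegree_XvC k c : (mdegree (Xv k + c%:C) <= 1)%N.
Proof. by rewrite mdegreeD ?mdegreeC ?mdegree_Xv. Qed.

Lemma mdegree_XvBC k c : (mdegree (Xv k - c%:C) <= 1)%N.
Proof. by rewrite -mpolyCN mdegree_XvC. Qed.

Definition slack_bound : R :=
  1 + \sum_j `|b j 0| + 2^-1 * (rho ^+ 2 + \sum_j \sum_k A j k ^+ 2).

Lemma slack_bound_gt0 : 0 < slack_bound.
Proof.
rewrite /slack_bound -addrA ltr_pwDl // addr_ge0 ?sumr_ge0 //.
by rewrite mulr_ge0 // addr_ge0 ?sqr_ge0 // ?sumr_ge0 // => j _;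
  rewrite sumr_ge0 // => k _; rewrite sqr_ge0.
Qed.

Lemma cone_slack_bound j : cone g 2 (slack_bound%:C - g (lift ord0 j)).
Proof.
pose c := slack_bound - (b j 0 + 2^-1 * (rho ^+ 2 + \sum_k A j k ^+ 2)).
have c0 : 0 <= c.
  rewrite /c subr_ge0 /slack_bound lerD //.
    rewrite (le_trans (ler_norm _)) // ler_wpDl // (bigD1 j) //= lerDl sumr_ge0 //.
  rewrite ler_wpM2l // lerD2l [leRHS](bigD1 j) //= lerDl sumr_ge0 // => i _.
  by rewrite sumr_ge0 // => k _; rewrite sqr_ge0.
have -> : slack_bound%:C - g (lift ord0 j) = c%:C +
    2^-1 *: ((rho ^+ 2)%:C - \sum_k Xv k ^+ 2) +
    2^-1 *: \sum_k (Xv k + (A j k)%:C) ^+ 2.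
  have -> : \sum_k (Xv k + (A j k)%:C) ^+ 2 = \sum_k Xv k ^+ 2 +
      2 *: \sum_k A j k *: Xv k + (\sum_k A j k ^+ 2)%:C.
    rewrite rmorph_sum /= scaler_sumr -!big_split; apply: eq_bigr => k _ /=.
    rewrite -!mul_mpolyC mpolyC_nat rmorphXn /=; ring.
  rewrite constraints_lift /c !mpolyCB !mpolyCD -!mul_mpolyC !mpolyCM mpolyCD.
  have : (2^-1)%:C * 2%:C = 1 :> {mpoly R[n]}.
    by rewrite -mpolyCM mulVf ?mpolyC1 // pnatr_eq0.
  move: (2^-1)%:C 2%:C => h t ht.
  by rewrite -[X in _ - (_ - X)]mul1r -ht; ring.
apply: coneD; first apply: coneD; first exact: coneC.
  by apply: coneZ => //; exact: cone_ball.
apply: coneZ => //; apply: cone_sum => k _; apply: cone_sqr_linear.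
exact: mdegree_XvC.
Qed.

Definition sqdist y : {mpoly R[n]} := \sum_k (Xv k - (y k 0)%:C) ^+ 2.

Lemma cone_sqdist y : cone g 2 (sqdist y).
Proof.
apply: cone_sum => k _; apply: cone_sqr_linear.
exact: mdegree_XvBC.
Qed.

(* The Lipschitz condition is squared to make it stable under products. *)
Definition tame f := exists B N, [/\ 0 <= B, cone g N (B%:C - f ^+ 2) &
  forall y, X y -> cone g N (B *: sqdist y - (f - (peval f y)%:C) ^+ 2)].

Lemma tameC c : tame c%:C.
Proof.
exists (c ^+ 2), 2; split; first exact: sqr_ge0.
  by rewrite rmorphXn subrr; exact: cone0.
move=> y _; rewrite pevalC subrr expr0n subr0.
by apply: coneZ (cone_sqdist y); exact: sqr_ge0.
Qed.

Lemma tameXv k : tame (Xv k).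
Proof.
exists (rho ^+ 2), 2; split; first exact: sqr_ge0.
  have -> : (rho ^+ 2)%:C - Xv k ^+ 2 = (rho ^+ 2)%:C - \sum_k Xv k ^+ 2 +
      \sum_(i | i != k) Xv i ^+ 2 by rewrite (bigD1 k) //=; ring.
  apply: coneD cone_ball _; apply: cone_sum => i _; apply: cone_sqr.
  by rewrite mdegree_Xv.
move=> y _; rewrite pevalXU /sqdist.
have -> : rho ^+ 2 *: sqdist y - (Xv k - (y k 0)%:C) ^+ 2 =
    (rho ^+ 2 - 1) *: sqdist y + \sum_(i | i != k) (Xv i - (y i 0)%:C) ^+ 2.
  by rewrite scalerBl scale1r {3}/sqdist (bigD1 k) //= /coords; ring.
apply: coneD.
  by apply: coneZ (cone_sqdist y); rewrite subr_ge0 expr_ge1 // (le_trans _ rho_ge1).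
apply: cone_sum => i _; apply: cone_sqr_linear.
exact: mdegree_XvBC.
Qed.

Lemma cone_sqr_any N p : cone g (N + 2 * mdegree p) (p ^+ 2).
Proof. by apply: cone_sqr; rewrite leq_addl. Qed.

Lemma tameM f h : tame f -> tame h -> tame (f * h).
Proof.
move=> [B [N [B0 fB fL]]] [B' [N' [B'0 hB hL]]].
exists (2 * B * B' + 2 * B * B'), (N + N' + 2 * mdegree f + 2 * mdegree h + 2)%N.
split; first by rewrite addr_ge0 // !mulr_ge0.
  have -> : (2 * B * B' + 2 * B * B')%:C - (f * h) ^+ 2 =
      f ^+ 2 * (B'%:C - h ^+ 2) + B' *: (B%:C - f ^+ 2) + (3 * B * B')%:C.
    by rewrite -!mul_mpolyC !(mpolyCD, mpolyCM, mpolyC1); ring.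
  apply: coneD; first apply: coneD.
  - apply: cone_leq (coneM (cone_sqr_any 0 f) hB); lia.
  - apply: cone_leq (coneZ B'0 fB); lia.
  - by apply: coneC; rewrite !mulr_ge0.
move=> y Xy; set fy := peval f y; set hy := peval h y.
have -> : peval (f * h) y = fy * hy by rewrite pevalM.
have hyB : 0 <= B' - hy ^+ 2.
  by have := cone_ge0 Xy hB; rewrite pevalB pevalC pevalXn.
have -> : (2 * B * B' + 2 * B * B') *: sqdist y - (f * h - (fy * hy)%:C) ^+ 2 =
    2 *: (f ^+ 2 * (B' *: sqdist y - (h - hy%:C) ^+ 2)) +
    (2 * B') *: (sqdist y * (B%:C - f ^+ 2)) +
    (2 * hy ^+ 2) *: (B *: sqdist y - (f - fy%:C) ^+ 2) +
    (2 * B * (B' - hy ^+ 2)) *: sqdist y +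
    (f * (h - hy%:C) - hy *: (f - fy%:C)) ^+ 2.
  rewrite -!mul_mpolyC !(mpolyCD, mpolyCM, mpolyCB, mpolyCN, mpolyC1); ring.
repeat apply: coneD.
- apply: coneZ => //; apply: cone_leq (coneM (cone_sqr_any 0 f) (hL y Xy)); lia.
- apply: coneZ; first by rewrite mulr_ge0.
  apply: cone_leq (coneM (cone_sqdist y) fB); lia.
- apply: coneZ; first by rewrite mulr_ge0 ?sqr_ge0.
  apply: cone_leq (fL y Xy); lia.
- apply: coneZ; first by rewrite !mulr_ge0.
  apply: cone_leq (cone_sqdist y); lia.
- apply: cone_leq (cone_sqr_any 0 _); rewrite add0n.
  suff: (mdegree (f * (h - hy%:C) - hy *: (f - fy%:C)) <= mdegree f + mdegree h)%N.
    by lia.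
  apply: mdegreeD.
    rewrite (leq_trans (mdegreeM _ _)) // leq_add2l.
    by rewrite mdegreeD ?mdegreeN ?mdegreeC.
  rewrite mdegreeN (leq_trans (mdegreeZ _ _)) // mdegreeD ?mdegreeN ?mdegreeC //.
  exact: leq_addr.
Qed.

Lemma tame_mpolyX a : tame (mpolyX R a).
Proof.
rewrite mpolyXE_id; apply: big_ind; [|exact: tameM|].
  by rewrite -mpolyC1; exact: tameC.
move=> i _; elim: (a i) => [|k IH]; first by rewrite expr0 -mpolyC1; exact: tameC.
by rewrite exprS; apply: tameM => //; exact: tameXv.
Qed.

Lemma lipschitz_certificate k : exists C N, 0 <= C /\ forall f,
  (msize f <= k.+1)%N -> (forall a : exponents n k, `|mcoeff a f| <= 1) ->
  forall y, X y -> forall d, 0 < d ->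
  cone g N (f - (peval f y)%:C + (C * d)%:C + (C / d) *: sqdist y).
Proof.
have tameB a : exists BN : R * nat, 0 <= BN.1 /\ forall y, X y ->
    cone g BN.2 (BN.1 *: sqdist y - (mpolyX R a - (peval (mpolyX R a) y)%:C) ^+ 2).
  by have [B [N [B0 _ BP]]] := tame_mpolyX a; exists (B, N).
have [BN BNP] := choice tameB.
pose E (a : exponents n k) := (1 + (BN a).1) / 2.
have E0 a : 0 <= E a by rewrite divr_ge0 // addr_ge0 //; have [] := BNP a.
exists (\sum_a E a), (\sum_(a : exponents n k) (BN a).2 + 2 * k + 2)%N.
split; first exact: sumr_ge0.
move=> f fk f1 y Xy d d0.
have -> : f - (peval f y)%:C + ((\sum_a E a) * d)%:C + (\sum_a E a) / d *: sqdist y =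
   \sum_(a : exponents n k) (mcoeff a f *: (mpolyX R a - (peval (mpolyX R a) y)%:C) +
     (E a * d)%:C + (E a / d) *: sqdist y).
  have -> : ((\sum_a E a) * d)%:C = \sum_a (E a * d)%:C.
    by rewrite mulr_suml (raddf_sum (@mpolyC n R)).
  rewrite !big_split /= mulr_suml scaler_suml; congr (_ + _ + _).
  rewrite [X in peval X y](mpolywE fk) {1}(mpolywE fk) peval_sum.
  rewrite (raddf_sum (@mpolyC n R)) /= -sumrB; apply: eq_bigr => a _.
  by rewrite pevalZ scalerBr -!mul_mpolyC mpolyCM.
apply: cone_sum => a _; have [B0 /(_ y Xy) aP] := BNP a.
set c := mcoeff a f; set S := sqdist y; set B := (BN a).1 in B0 aP *.
set u := mpolyX R a - _ in aP *.
have -> : c *: u + (E a * d)%:C + (E a / d) *: S =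
    (2 * d)^-1 *: (u + (d * c)%:C) ^+ 2 + (2 * d)^-1 *: (B *: S - u ^+ 2) +
    (d / 2 * (1 - c ^+ 2) + B * d / 2)%:C + (2 * d)^-1 *: S.
  have -> : (d / 2 * (1 - c ^+ 2) + B * d / 2) =
    E a * d - (2 * d)^-1 * (d * c) ^+ 2 by rewrite /E -/B; field; rewrite gt_eqF.
  have -> : E a / d = (2 * d)^-1 * B + (2 * d)^-1 by rewrite /E -/B; field; rewrite gt_eqF.
  have -> : c *: u = (2 * d)^-1 *: (2 *: (d *: (c *: u))).
    by rewrite !scalerA; congr (_ *: _); field; rewrite gt_eqF.
  rewrite -!mul_mpolyC !(mpolyCD, mpolyCB, mpolyCM, mpolyC1).
  by move: ((2 * d)^-1) => h; ring.
have h0 : 0 <= (2 * d)^-1 by rewrite invr_ge0 mulr_ge0 // ltW.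
have ua : (mdegree u <= k)%N.
  rewrite mdegreeD ?mdegreeN ?mdegreeC //.
  by rewrite /mdegree msizeX /= -ltnS bmdeg.
apply: coneD; first apply: coneD; first apply: coneD.
- apply: coneZ => //; apply: cone_sqr.
  have : (mdegree (u + (d * c)%:C) <= k)%N by rewrite mdegreeD ?mdegreeC.
  by move: (mdegree _) (\sum_(_ | _) _)%N => i j; lia.
- apply: coneZ => //; apply: cone_leq aP.
  rewrite (bigD1 a) //=; by move: (BN a).2 (\sum_(_ | _) _)%N => i j; lia.
- apply: coneC; rewrite addr_ge0 ?divr_ge0 ?mulr_ge0 ?(ltW d0) // subr_ge0.
  by rewrite -real_normK ?num_real // expr_le1 // f1.
- apply: coneZ => //; apply: cone_leq (cone_sqdist y).
  by move: (\sum_(_ | _) _)%N => i; lia.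
Qed.

Lemma cone_cauchy_schwarz (I : finType) (a : I -> R) (u : I -> {mpoly R[n]}) :
  (forall l, (mdegree (u l) <= 1)%N) ->
  cone g 2 ((\sum_l a l ^+ 2) *: \sum_l u l ^+ 2 - (\sum_l a l *: u l) ^+ 2).
Proof.
move=> u1.
have -> : (\sum_l a l ^+ 2) *: \sum_l u l ^+ 2 - (\sum_l a l *: u l) ^+ 2 =
    2^-1 *: \sum_i \sum_j ((a i)%:C * u j - (a j)%:C * u i) ^+ 2.
  rewrite lagrange_identity -(mpolyC_nat n R 2) mul_mpolyC scalerA.
  rewrite mulVf ?pnatr_eq0 // scale1r; congr (_ - _ ^+ 2).
    rewrite -mul_mpolyC (raddf_sum (@mpolyC n R)); congr (_ * _).
    by apply: eq_bigr => i _; rewrite /= !expr2 mpolyCM.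
  by apply: eq_bigr => i _; rewrite mul_mpolyC.
apply: coneZ; first by rewrite invr_ge0.
apply: cone_sum => i _; apply: cone_sum => j _; apply: cone_sqr_linear.
by rewrite mdegreeD ?mdegreeN ?mul_mpolyC // (leq_trans (mdegreeZ _ _)).
Qed.

Hypothesis X_neq0 : X !=set0.

Definition slack_error (s : 'I_m -> R) : {mpoly R[n]} :=
  \sum_j ((s j)%:C - g (lift ord0 j)) ^+ 2.

Lemma nearby_point : exists C, 0 <= C /\ forall s : 'I_m -> R, (forall j, 0 <= s j) ->
  exists2 y, X y & cone g 2 (C *: slack_error s - sqdist y).
Proof.
have [c [c0 cP]] := polytope_error_bound X_neq0.
have BA := mulVpmx (bounded_polytope_row_full X_neq0 X_ball).
set B := pinvmx A in BA; pose E : 'M[R]_m := 1%:M - A *m B.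
have EA : E *m A = 0 by rewrite mulmxBl mul1mx -mulmxA BA mulmx1 subrr.
pose be := \sum_k \sum_l B k l ^+ 2; pose ep := \sum_j \sum_l E j l ^+ 2.
have be0 : 0 <= be by do 2 (apply: sumr_ge0 => ? _); exact: sqr_ge0.
have ep0 : 0 <= ep by do 2 (apply: sumr_ge0 => ? _); exact: sqr_ge0.
exists (2 * be + 2 * c ^+ 2 * ep *+ n); split.
  by rewrite addr_ge0 ?mulrn_wge0 ?mulr_ge0 // sqr_ge0.
move=> s s0; pose d : 'cV[R]_m := \col_j s j - b.
pose u l : {mpoly R[n]} := (s l)%:C - g (lift ord0 l).
have u1 l : (mdegree (u l) <= 1)%N.
  by rewrite mdegreeD ?mdegreeN ?mdegreeC // mdegree_constraints_lift.
have lin o (M : 'M[R]_(o, m)) i : \sum_l M i l *: u l =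
    ((M *m d) i 0)%:C + \sum_k (M *m A) i k *: Xv k.
  have -> : ((M *m d) i 0)%:C = \sum_l M i l *: (d l 0)%:C.
    rewrite mxE (raddf_sum (@mpolyC n R)); apply: eq_bigr => l _.
    by rewrite -mul_mpolyC -mpolyCM.
  have -> : \sum_k (M *m A) i k *: Xv k = \sum_l M i l *: \sum_k A l k *: Xv k.
    under eq_bigr do rewrite mxE scaler_suml.
    rewrite exchange_big; apply: eq_bigr => l _; rewrite scaler_sumr.
    by apply: eq_bigr => k _; rewrite scalerA.
  rewrite -big_split; apply: eq_bigr => l _ /=; rewrite -scalerDr; congr (_ *: _).
  rewrite /u constraints_lift !mxE mpolyCB; ring.
pose z : 'cV[R]_n := - (B *m d).
have XzE k : Xv k - (z k 0)%:C = \sum_l B k l *: u l.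
  rewrite lin BA [z k 0]mxE mpolyCN opprK addrC; congr (_ + _).
  rewrite (bigD1 k) //= mxE eqxx scale1r big1 ?addr0 // => i ik.
  by rewrite mxE eq_sym (negbTE ik) scale0r.
pose e j := (E *m d) j 0.
have eE j : (e j)%:C = \sum_l E j l *: u l.
  rewrite lin EA big1 ?addr0 // => k _; by rewrite mxE scale0r.
pose e2 := \sum_j e j ^+ 2.
have e20 : 0 <= e2 by apply: sumr_ge0 => j _; exact: sqr_ge0.
have [|j|y Xy zy] := cP z (Num.sqrt e2); first exact: sqrtr_ge0.
  have ej : e j <= Num.sqrt e2 by exact: le_trans (ler_norm _) (coord_le_enorm e j).
  have -> : (A *m z) j 0 = b j 0 + e j - s j.
    rewrite /e /E mulmxBl mul1mx -mulmxA /z mulmxN !mxE; ring.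
  by have := s0 j; move: ej; lra.
exists y => //; set Q := slack_error s.
have cone_B k : cone g 2 ((\sum_l B k l ^+ 2) *: Q - (Xv k - (z k 0)%:C) ^+ 2).
  by rewrite XzE; exact: cone_cauchy_schwarz.
have cone_e : cone g 2 (ep *: Q - e2%:C).
  rewrite /ep /e2 scaler_suml (raddf_sum (@mpolyC n R)) -sumrB.
  apply: cone_sum => j _; rewrite /= [e j ^+ 2]expr2 mpolyCM -expr2 eE.
  exact: cone_cauchy_schwarz.
have -> : (2 * be + 2 * c ^+ 2 * ep *+ n) *: Q - sqdist y =
    \sum_k ((2 * \sum_l B k l ^+ 2 + 2 * c ^+ 2 * ep) *: Q
             - (Xv k - (y k 0)%:C) ^+ 2).
  rewrite sumrB -scaler_suml big_split /= -mulr_sumr sumr_const card_ord //.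
apply: cone_sum => k _; set P := Xv k - (z k 0)%:C in cone_B *.
pose t := z k 0 - y k 0.
have t2 : 0 <= c ^+ 2 * e2 - t ^+ 2.
  rewrite subr_ge0 -[t ^+ 2]real_normK ?num_real // -(sqr_sqrtr e20) -exprMn.
  by rewrite ler_sqr ?nnegrE ?mulr_ge0 ?sqrtr_ge0 //; exact: zy.
have -> : (2 * \sum_l B k l ^+ 2 + 2 * c ^+ 2 * ep) *: Q - (Xv k - (y k 0)%:C) ^+ 2 =
    2 *: ((\sum_l B k l ^+ 2) *: Q - P ^+ 2) + (P - t%:C) ^+ 2 +
    (2 * c ^+ 2) *: (ep *: Q - e2%:C) + (2 * (c ^+ 2 * e2 - t ^+ 2))%:C.
  rewrite /t /P -!mul_mpolyC !(mpolyCD, mpolyCB, mpolyCM, mpolyC1).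
  by move: (\sum_l B k l ^+ 2) => beta; ring.
apply: coneD; first apply: coneD; first apply: coneD.
- by apply: coneZ.
- apply: cone_sqr_linear; rewrite /P -addrA -mpolyCN -mpolyCB; exact: mdegree_XvC.
- by apply: coneZ => //; rewrite mulr_ge0 ?sqr_ge0.
- by apply: coneC; rewrite mulr_ge0.
Qed.

Lemma mdegree_horner_alg d (u : {mpoly R[n]}) (P : {poly R}) : (mdegree u <= 1)%N ->
  (size P <= d.+1)%N -> (mdegree (horner_alg u P) <= d)%N.
Proof.
move=> u1 Pd; rewrite -[P]coefK poly_def rmorph_sum mdegree_sum // => i.
rewrite /= linearZ rmorphXn /= horner_algX mulr_algl.
rewrite (leq_trans (mdegreeZ _ _)) //.
have : (i <= d)%N by rewrite -ltnS (leq_trans (ltn_ord i)).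
apply: leq_trans; elim: (i : nat) => [|k IH]; first by rewrite expr0 -mpolyC1 mdegreeC.
by rewrite exprS (leq_trans (mdegreeM _ _)) // -add1n leq_add.
Qed.

Lemma cone_horner_alg d (u : {mpoly R[n]}) (w : {poly R}) : (mdegree u <= 1)%N ->
  cone g 3 (1 - u ^+ 2) -> interval_sos d w -> cone g (2 * d + 3) (horner_alg u w).
Proof.
move=> u1 u2 [s sP ->]; rewrite rmorph_sum /= big_seq; apply: cone_sum => x xs.
have /andP[P1 P2] := allP sP x xs.
have -> : horner_alg u (x.1 ^+ 2 + (1 - 'X ^+ 2) * x.2 ^+ 2) =
    horner_alg u x.1 ^+ 2 + (1 - u ^+ 2) * horner_alg u x.2 ^+ 2.
  by rewrite rmorphD rmorphXn /= rmorphM rmorphB !rmorphXn rmorph1 /= horner_algX.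
apply: coneD.
  apply: cone_sqr; have := mdegree_horner_alg u1 P1.
  by move: (mdegree (horner_alg _ _)) => k; lia.
apply: cone_leq (coneM u2 (@cone_sqr _ _ _ g _ (horner_alg u x.2) (leqnn _))).
have : (mdegree (horner_alg u x.2) <= d)%N by apply: mdegree_horner_alg => //; exact: leqW.
by move: (mdegree (horner_alg _ _)) => k; lia.
Qed.

Definition rescaled_slack j : {mpoly R[n]} :=
  (2 / slack_bound) *: g (lift ord0 j) - 1.

Lemma mdegree_rescaled_slack j : (mdegree (rescaled_slack j) <= 1)%N.
Proof.
rewrite mdegreeD //; last by rewrite mdegreeN /mdegree msize1.
by rewrite (leq_trans (mdegreeZ _ _)) // mdegree_constraints_lift.
Qed.

Lemma cone_rescaled_slack j : cone g 3 (1 - rescaled_slack j ^+ 2).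
Proof.
have D0 := slack_bound_gt0; have D0' : slack_bound != 0 by rewrite gt_eqF.
have -> : 1 - rescaled_slack j ^+ 2 = (2 / slack_bound * (2 / slack_bound)) *:
    (g (lift ord0 j) * (slack_bound%:C - g (lift ord0 j))).
  have h1 : (2 / slack_bound)%:C * slack_bound%:C = 2 :> {mpoly R[n]}.
    by rewrite -mpolyCM mulfVK // mpolyC_nat.
  rewrite /rescaled_slack; move: (2 / slack_bound) h1 => h'.
  rewrite -!mul_mpolyC mpolyCM; move: h'%:C slack_bound%:C (g _) => h D G h1.
  transitivity ((h * G) * (h * D - h * G)); last ring.
  by rewrite h1; ring.
apply: coneZ; first by rewrite -expr2 sqr_ge0.
exact: coneM (cone_lift j) (cone_slack_bound j).
Qed.

Lemma effective_certificate k : exists (C : R) K, 0 <= C /\ forall f,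
  (msize f <= k.+1)%N -> (forall a : exponents n k, `|mcoeff a f| <= 1) ->
  forall c, (forall x, X x -> c <= peval f x) ->
  forall r, (0 < r)%N -> (K <= r)%N -> cone g (2 * r) (f - c%:C + (C / r%:R)%:C).
Proof.
have [C1 [N1 [C10 lip]]] := lipschitz_certificate k.
have [C2 [C20 near_pt]] := nearby_point.
have D0 := slack_bound_gt0; set D := slack_bound in D0.
pose C3 := C1 * (1 + C2 * (m%:R * ((D / 2) ^+ 2 * 9))).
have C30 : 0 <= C3.
  by rewrite mulr_ge0 // addr_ge0 // !mulr_ge0 // ltW.
pose K := (N1 + 7 * m + 9)%N.
exists (2 * K%:R * C3), K; split; first by rewrite mulr_ge0 // mulr_ge0.
move=> f fk f1 c cf r r0 Kr; pose p := (r %/ K)%N.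
have K0 : (0 < K)%N by rewrite /K addnS.
have p0 : (0 < p)%N by rewrite divn_gt0.
have pr : (p * K <= r)%N by exact: leq_trunc_div.
have rp : (r <= 2 * K * p)%N.
  by have := ltn_ceil r K0; rewrite -/p; nia.
have pR : 0 < p%:R :> R by rewrite ltr0n.
have rR : 0 < r%:R :> R by rewrite ltr0n.
have [N [s [w [v [s1 wP vP w1 sw]]]]] := localized_weights R p0.
pose u j := rescaled_slack j.
pose W (L : {ffun 'I_m -> 'I_N}) := \prod_j horner_alg (u j) (w (L j)).
pose sg (L : {ffun 'I_m -> 'I_N}) j := D / 2 * (1 + s (L j)).
have sg0 L j : 0 <= sg L j.
  have /andP[h _] := s1 (L j); rewrite mulr_ge0 ?divr_ge0 ?(ltW D0) //; lra.
have coneW L : cone g (m * (2 * (2 * p) + 3)) (W L).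
  suff: cone g (#|'I_m| * (2 * (2 * p) + 3)) (W L) by rewrite card_ord.
  apply: cone_prod => j; apply: cone_horner_alg => //.
    exact: mdegree_rescaled_slack.
  exact: cone_rescaled_slack.
have w1' j : \sum_l horner_alg (u j) (w l) = 1.
  by rewrite -rmorph_sum w1 rmorph1.
have sumW : \sum_L W L = 1.
  rewrite -(bigA_distr_bigA (fun j l => horner_alg (u j) (w l))) big1 //.
have slackE j l : (D / 2 * (1 + s l))%:C - g (lift ord0 j) =
    (D / 2) *: ((s l)%:C - u j).
  rewrite /u /rescaled_slack -/D scalerBr scalerBr scalerA.
  have -> : D / 2 * (2 / D) = 1 by field; rewrite gt_eqF.
  by rewrite scale1r -!mul_mpolyC mulr1 mulrDr mulr1 mpolyCD [(_ * s l)%:C]mpolyCM; ring.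
have slackW : \sum_L W L * slack_error (sg L) =
    \sum_j (D / 2) ^+ 2 *: ((9 / p%:R ^+ 2)%:C - horner_alg (u j) v).
  under eq_bigr do rewrite /slack_error mulr_sumr.
  rewrite exchange_big; apply: eq_bigr => j _ /=.
  rewrite (sum_prod_marginal
    (fun l => ((D / 2 * (1 + s l))%:C - g (lift ord0 j)) ^+ 2) j w1').
  have -> : (9 / p%:R ^+ 2)%:C - horner_alg (u j) v =
      \sum_l ((s l)%:C - u j) ^+ 2 * horner_alg (u j) (w l).
    have aC (a : R) : horner_alg (u j) a%:P = a%:C :> {mpoly R[n]}.
      by rewrite horner_algC -mul_mpolyC mulr1.
    rewrite -aC -rmorphB -sw rmorph_sum; apply: eq_bigr => l _.
    by rewrite rmorphM rmorphXn rmorphB /= aC horner_algX.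
  rewrite scaler_sumr; apply: eq_bigr => l _.
  by rewrite slackE exprZn -scalerAr; congr (_ *: _); exact: mulrC.
have ypt L := cid2 (near_pt (sg L) (sg0 L)).
pose y L := projT1 (ypt L).
have Xy L : X (y L) by rewrite /y; case: (ypt L).
have yP L : cone g 2 (C2 *: slack_error (sg L) - sqdist (y L)) by rewrite /y; case: (ypt L).
have -> : f - c%:C + (2 * K%:R * C3 / r%:R)%:C =
    \sum_L W L * (f - (peval f (y L))%:C + (C1 * p%:R^-1)%:C +
      (C1 / p%:R^-1) *: sqdist (y L)) +
    \sum_L (peval f (y L) - c) *: W L +
    (C1 * p%:R) *: \sum_L W L * (C2 *: slack_error (sg L) - sqdist (y L)) +
    (C1 * p%:R * C2 * (D / 2) ^+ 2) *: \sum_j horner_alg (u j) v +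
    (2 * K%:R * C3 / r%:R - C3 / p%:R)%:C.
  set Fy := \sum_L peval f (y L) *: W L.
  set S := \sum_L W L * sqdist (y L).
  set V := \sum_j horner_alg (u j) v.
  have -> : \sum_L W L * (f - (peval f (y L))%:C + (C1 * p%:R^-1)%:C +
      (C1 / p%:R^-1) *: sqdist (y L)) = f + (C1 / p%:R)%:C - Fy + (C1 * p%:R) *: S.
    transitivity (\sum_L (W L * (f + (C1 / p%:R)%:C) - peval f (y L) *: W L +
        (C1 * p%:R) *: (W L * sqdist (y L)))).
      apply: eq_bigr => L _; rewrite invrK -!mul_mpolyC; ring.
    by rewrite big_split sumrB /= -mulr_suml sumW mul1r -scaler_sumr.
  have -> : \sum_L (peval f (y L) - c) *: W L = Fy - c%:C.
    under eq_bigr do rewrite scalerBl.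
    by rewrite sumrB -scaler_sumr sumW -mul_mpolyC mulr1.
  have -> : \sum_L W L * (C2 *: slack_error (sg L) - sqdist (y L)) =
      (C2 * (D / 2) ^+ 2) *: ((m%:R * (9 / p%:R ^+ 2))%:C - V) - S.
    transitivity (\sum_L (C2 *: (W L * slack_error (sg L)) - W L * sqdist (y L))).
      by apply: eq_bigr => L _; rewrite mulrBr -scalerAr.
    rewrite sumrB -scaler_sumr slackW -scaler_sumr scalerA; congr (_ *: _ - _).
    rewrite sumrB sumr_const card_ord; congr (_ - _).
    by move: (9 / p%:R ^+ 2) => z; rewrite mulr_natl (raddfMn (@mpolyC n R)).
  have -> : 2 * K%:R * C3 / r%:R - C3 / p%:R = 2 * K%:R * C3 / r%:R - C1 / p%:R -
      C1 * p%:R * (C2 * (D / 2) ^+ 2 * (m%:R * (9 / p%:R ^+ 2))).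
    by rewrite /C3; field; rewrite !gt_eqF.
  rewrite -!mul_mpolyC !(mpolyCB, mpolyCM); ring.
have coneWN L N' : (N' <= N1 + 4)%N -> forall q, cone g N' q -> cone g (2 * r) (W L * q).
  move=> N'N q qN; apply: cone_leq (coneM (coneW L) qN).
  by move: pr p0; rewrite /K; nia.
have r2 : (2 * (2 * p) + 3 <= 2 * r)%N by move: pr p0; rewrite /K; nia.
have C1p : 0 <= C1 * p%:R by rewrite mulr_ge0.
repeat apply: coneD.
- apply: cone_sum => L _; apply: (coneWN L N1); first exact: leq_addr.
  by apply: lip => //; rewrite invr_gt0.
- apply: cone_sum => L _; apply: coneZ; first by rewrite subr_ge0 cf.
  rewrite -[W L]mulr1; apply: (coneWN L 0%N) => //.
  by rewrite -mpolyC1; apply: coneC.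
- apply: coneZ => //; apply: cone_sum => L _; apply: (coneWN L 2%N) => //.
  by rewrite (leq_trans _ (leq_addl _ _)).
- apply: coneZ; first by rewrite !mulr_ge0 // ?divr_ge0 // ltW.
  apply: cone_sum => j _; apply: cone_leq r2 _; apply: cone_horner_alg => //.
    exact: mdegree_rescaled_slack.
  exact: cone_rescaled_slack.
- apply: coneC; rewrite subr_ge0 ler_pdivrMr // mulrAC ler_pdivlMr //.
  rewrite [leRHS](_ : _ = C3 * (2 * K * p)%:R); last by rewrite !natrM; ring.
  by rewrite ler_wpM2l // ler_nat.
Qed.

End PolytopeCertificates.

(** * Rates of convergence *)

Lemma meval_continuous (R : realType) (n : nat) (T : topologicalType)
    (phi : T -> 'I_n -> R) (p : {mpoly R[n]}) :
  (forall i, continuous (fun t => phi t i)) -> continuous (fun t => meval (phi t) p).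
Proof.
move=> phic; have -> : (fun t => meval (phi t) p) =
    (fun t => \sum_(a <- msupp p) mcoeff a p * \prod_i phi t i ^+ a i).
  by apply/funext => t; rewrite mevalE.
have cstc (c : R) : continuous ((fun=> c) : T -> R) by move=> t; exact: cvg_cst.
have contM (F G : T -> R) : continuous F -> continuous G ->
    continuous (fun t => F t * G t).
  by move=> Fc Gc t; exact: (continuousM (Fc t) (Gc t)).
have contD (F G : T -> R) : continuous F -> continuous G ->
    continuous (fun t => F t + G t).
  by move=> Fc Gc t; exact: (continuousD (Fc t) (Gc t)).
have bigc op (idx : R) (I : Type) (s : seq I) (F : I -> T -> R) :
    (forall G H : T -> R, continuous G -> continuous H ->
      continuous (fun t => op (G t) (H t))) ->
    (forall i, continuous (F i)) -> continuous (fun t => \big[op/idx]_(i <- s) F i t).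
  move=> opc Fc; elim: s => [|i s IH].
    by rewrite (_ : (fun t => _) = fun=> idx) //; apply/funext => t; rewrite big_nil.
  rewrite (_ : (fun t => _) = fun t => op (F i t) (\big[op/idx]_(i <- s) F i t)).
    exact: opc.
  by apply/funext => t; rewrite big_cons.
apply: (bigc) => // a; apply: (contM) => //; apply: (bigc) => // i.
elim: (a i) => [|k IH].
  by rewrite (_ : (fun t => _) = fun=> 1) //; apply/funext => t; rewrite expr0.
rewrite (_ : (fun t => _) = fun t => phi t i * phi t i ^+ k); first exact: contM.
by apply/funext => t; rewrite exprS.
Qed.

Lemma peval_continuous (R : realType) (n : nat) (p : {mpoly R[n]}) :
  continuous (peval p : 'cV[R]_n -> R).
Proof. by apply: meval_continuous => i; exact: coord_continuous. Qed.

Lemma edist_le_of_support (R : realType) (I : finType) (S V : set (I -> R))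
    (y : I -> R) (eps M : R) : 0 <= eps -> 0 <= M -> S !=set0 ->
  (forall z v t, S z -> V v -> 0 <= t <= 1 ->
    S (fun i => (1 - t) * z i + t * v i)) ->
  (forall v i, V v -> `|v i| <= M) ->
  (forall f : I -> R, (forall i, `|f i| <= 1) ->
    exists2 v, V v & \sum_i f i * v i <= \sum_i f i * y i + eps) ->
  (edist_set y S <= eps%:E)%E.
Proof.
move=> eps0 M0 [z0 Sz0] mix VM supp; rewrite leNgt; apply/negP => lt_eps.
have d_le z : S z -> (edist_set y S <= (enorm (fun i => y i - z i))%:E)%E.
  by move=> Sz; apply: ereal_inf_lbound; exists z.
have inf_lt := @ereal_inf_lt R [set (enorm (fun i => y i - w i))%:E | w in S].
rewrite -/(edist_set y S) in inf_lt.
move: lt_eps d_le inf_lt (d_le _ Sz0); case: (edist_set y S) => [d| |] //= + d_le inf_lt _.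
rewrite lte_fin => eps_d.
have d0 : 0 < d by exact: le_lt_trans eps_d.
pose ga := d * (d - eps); have ga0 : 0 < ga by rewrite mulr_gt0 // subr_gt0.
pose B := 2 * \sum_i (M + `|y i|) ^+ 2 + 2 * (d + 1) ^+ 2.
have B0 : 0 <= B.
  by rewrite addr_ge0 // mulr_ge0 ?sqr_ge0 // sumr_ge0 // => i _; exact: sqr_ge0.
have Bga0 : 0 < B + ga + 1 by lra.
pose t := ga / (B + ga + 1).
have t0 : 0 < t by rewrite divr_gt0.
have t1 : t <= 1 by rewrite ler_pdivrMr // mul1r; lra.
have tB : t * B <= ga.
  rewrite /t mulrAC ler_pdivrMr // ler_wpM2l // ?(ltW ga0) //; lra.
pose eta := Num.min 1 (t * ga / (2 * d + 1)).
have d1 : 0 < 2 * d + 1 by lra.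
have eta0 : 0 < eta by rewrite lt_min ltr01 /= divr_gt0 // mulr_gt0.
have eta1 : eta <= 1 by rewrite ge_min lexx.
have eta_ga : eta * (2 * d + 1) <= t * ga.
  by rewrite -ler_pdivlMr // ge_min lexx orbT.
have [|_ [z Sz <-]] := inf_lt (d + eta)%:E; first by rewrite lte_fin ltrDl.
rewrite lte_fin; pose u i := y i - z i; rewrite -/u => un.
have dn : d <= enorm u by rewrite -lee_fin; exact: d_le.
have n0 : 0 < enorm u by exact: lt_le_trans dn.
pose U := \sum_i u i ^+ 2.
have U0 : 0 <= U by apply: sumr_ge0 => i _; exact: sqr_ge0.
have UE : enorm u ^+ 2 = U by rewrite /enorm sqr_sqrtr.
have [|v Vv fv] := supp (fun i => - u i / enorm u).
  move=> i; rewrite normrM normrN normfV (ger0_norm (ltW n0)) ler_pdivrMr // mul1r.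
  exact: coord_le_enorm.
pose P := \sum_i u i * (v i - z i).
have Pga : ga <= P.
  have PE : P = U - \sum_i u i * (y i - v i).
    by rewrite /P /U -sumrB; apply: eq_bigr => i _; rewrite /u; ring.
  have : \sum_i u i * (y i - v i) <= eps * enorm u.
    rewrite -ler_pdivrMr // -lerBlDl in fv *.
    rewrite -sumrB in fv; apply: le_trans fv; rewrite le_eqVlt; apply/orP; left; apply/eqP.
    by rewrite mulr_suml; apply: eq_bigr => i _; ring.
  by rewrite PE -UE /ga; nra.
pose Q := \sum_i (v i - z i) ^+ 2.
have QB : Q <= B.
  apply: (@le_trans _ _ (2 * \sum_i (M + `|y i|) ^+ 2 + 2 * U)).
    rewrite /U !mulr_sumr -big_split; apply: ler_sum => i _ /=.
    have h1 : `|v i - y i| <= M + `|y i|.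
      by rewrite (le_trans (ler_normB _ _)) // lerD2r VM.
    have h2 : (v i - y i) ^+ 2 <= (M + `|y i|) ^+ 2.
      by rewrite -[leLHS]real_normK ?num_real // ler_sqr ?nnegrE // addr_ge0.
    have h3 : 0 <= ((v i - y i) - u i) ^+ 2 by exact: sqr_ge0.
    by move: h2 h3; rewrite /u; nra.
  by rewrite /B lerD2l ler_pM2l // -UE ler_sqr ?nnegrE; lra.
have := d_le _ (mix z v t Sz Vv _); rewrite (ltW t0) t1 => /(_ isT).
rewrite lee_fin => dt.
have : d ^+ 2 <= U - 2 * t * P + t ^+ 2 * Q.
  have -> : U - 2 * t * P + t ^+ 2 * Q =
      \sum_i (y i - ((1 - t) * z i + t * v i)) ^+ 2.
    rewrite /U /P /Q !mulr_sumr -sumrB -big_split; apply: eq_bigr => i _ /=.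
    by rewrite /u; ring.
  rewrite -[leRHS]sqr_sqrtr; last by apply: sumr_ge0 => i _; exact: sqr_ge0.
  by rewrite ler_sqr ?nnegrE ?sqrtr_ge0 // ltW.
have h1 : t ^+ 2 * Q <= t * ga by rewrite expr2 -mulrA ler_pM2l // (le_trans _ tB) // ler_pM2l.
have h2 : t * ga <= t * P by rewrite ler_pM2l.
have h3 : U < (d + eta) ^+ 2 by rewrite -UE ltr_sqr ?nnegrE; lra.
have h4 : eta * eta <= eta by rewrite ler_piMl // ltW.
by move: h1 h2 h3 h4 eta_ga; nra.
Qed.

Section Mixture.
Context d (T : measurableType d) (R : realType) (s t : R).
Hypotheses (s_ge0 : 0 <= s) (t_ge0 : 0 <= t).
Variables P Q : {measure set T -> \bar R}.

Definition mixture : set T -> \bar R :=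
  measure_add (mscale (NngNum s_ge0) P) (mscale (NngNum t_ge0) Q).

HB.instance Definition _ := measure_function.Measure.on mixture.

End Mixture.

Section Rates.
Variables (R : realType) (m n : nat) (A : 'M[R]_(m, n)) (b : 'cV[R]_m) (rho : R).
Hypothesis rho_ge1 : 1 <= rho.
Hypothesis X_neq0 : polytope A b !=set0.
Hypothesis X_ball : polytope A b `<=` eball rho.
Local Notation X := (polytope A b).
Local Notation g := (constraints A b rho).
Local Notation "c %:C" := (mpolyC n c) (at level 1, format "c %:C").
Implicit Types (f p q : {mpoly R[n]}) (x y : 'cV[R]_n).

Lemma polytopeE : X = \bigcap_(j in [set: 'I_m])
  (peval (g (lift ord0 j)) @^-1` [set t : R | 0 <= t]).
Proof.
apply/seteqP; split=> x.
  by move=> Xx j _ /=; rewrite peval_constraints_lift subr_ge0 Xx.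
by move=> Xx j; have := Xx j I; rewrite /= peval_constraints_lift subr_ge0.
Qed.

Lemma closed_polytope : closed X.
Proof.
rewrite polytopeE; apply: closed_bigI => j _; apply: preimage_closed.
  by move=> x _; exact: peval_continuous.
exact: closed_ge.
Qed.

Lemma coord_le x k : X x -> `|x k 0| <= rho.
Proof. by move=> /X_ball; apply: le_trans; exact: (coord_le_enorm (coords x)). Qed.

(* Heine-Borel is available for row vectors only. *)
Lemma polytope_min f : exists c, is_min f X c.
Proof.
pose Y : set 'rV[R]_n := [set v | X v^T].
have phic i : continuous (fun v : 'rV[R]_n => v^T i 0).
  by move=> v; under eq_fun do rewrite mxE; exact: coord_continuous.
have evc p : continuous (fun v : 'rV[R]_n => peval p v^T).
  by apply: meval_continuous => i; exact: phic.
have Ycl : closed Y.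
  rewrite (_ : Y = \bigcap_(j in [set: 'I_m])
      ((fun v => peval (g (lift ord0 j)) v^T) @^-1` [set t : R | 0 <= t])).
    apply: closed_bigI => j _; apply: preimage_closed; last exact: closed_ge.
    by move=> v _; exact: evc.
  by apply/seteqP; split=> v; rewrite /Y /= polytopeE.
have rho0 : 0 <= rho by exact: le_trans rho_ge1.
have Ybd : bounded_set Y.
  exists rho; split; first exact: num_real.
  move=> M rhoM v Yv; rewrite /Num.norm /= mx_normrE; apply/bigmax_le => [|[i k] _ /=].
    exact: ltW (le_lt_trans rho0 rhoM).
  rewrite ord1; apply: le_trans (ltW rhoM).
  by have := coord_le k Yv; rewrite mxE.
have Y0 : Y !=set0 by have [x Xx] := X_neq0; exists x^T; rewrite /Y /= trmxK.
have [v vY vmin] := EVT_min_rV (f := fun v => peval f v^T) Y0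
  (bounded_closed_compact Ybd Ycl) (continuous_subspaceT (evc f)).
exists (peval f v^T); split.
  by exists v^T => //; exact: set_mem vY.
move=> x Xx; rewrite -[x in X in _ <= X]trmxK; apply: vmin.
by apply/mem_set; rewrite /Y /= trmxK.
Qed.

Lemma certificate_rate f c : (forall x, X x -> c <= peval f x) ->
  exists C, 0 <= C /\ \forall r \near \oo, cone g (2 * r) (f - (c - C / r%:R)%:C).
Proof.
move=> fc; have [C [K [C0 cert]]] := effective_certificate X_ball rho_ge1 X_neq0 (msize f).
pose M := 1 + \sum_(a : exponents n (msize f)) `|mcoeff a f|.
have M1 : 1 <= M by rewrite lerDl sumr_ge0.
have M0 : 0 < M by exact: lt_le_trans M1.
exists (M * C); split; first by rewrite mulr_ge0 // ltW.
near=> r.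
have -> : f - (c - M * C / r%:R)%:C =
    M *: (M^-1 *: f - (M^-1 * c)%:C + (C / r%:R)%:C).
  rewrite !scalerDr scalerN scalerA divff ?gt_eqF // scale1r -!mul_mpolyC -!mpolyCM.
  rewrite mulrA divff ?gt_eqF // mul1r mpolyCB mulrA; ring.
apply: coneZ; first exact: ltW.
apply: cert.
- by rewrite (leq_trans (msizeZ_le _ _)).
- move=> a; rewrite mcoeffZ normrM ger0_norm ?invr_ge0 ?(ltW M0) //.
  rewrite mulrC ler_pdivrMr // mul1r /M (bigD1 a) //= addrCA lerDl.
  by rewrite addr_ge0 // sumr_ge0.
- by move=> x Xx; rewrite pevalZ ler_wpM2l ?invr_ge0 ?(ltW M0) ?fc.
- near: r; exact: nbhs_infty_gt.
- near: r; exact: nbhs_infty_ge.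
Unshelve. all: by end_near. Qed.

Lemma abse_sub_le (c e : R) (l : \bar R) :
  ((c - e)%:E <= l)%E -> (l <= c%:E)%E -> (`|c%:E - l| <= e%:E)%E.
Proof.
case: l => [l| |] //; rewrite !lee_fin => h1 h2.
by rewrite ger0_norm ?subr_ge0 //; lra.
Qed.

Lemma lb_rate f c : is_min f X c ->
  bigO_inv (fun r => c%:E - lb f (truncated_preordering g r))%E.
Proof.
move=> [[x0 Xx0 fx0] fmin]; have [C [C0 cert]] := certificate_rate fmin.
exists C; near=> r; apply: abse_sub_le.
  apply: ereal_sup_ubound; exists (c - C / r%:R) => //=.
  by apply: cone_preordering; near: r.
apply: ge_ereal_sup => _ [a /= aT <-]; rewrite lee_fin -fx0 -subr_ge0.
by have := preordering_ge0 (constraints_ge0 X_ball rho_ge1 Xx0) aT; rewrite pevalB pevalC.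
Unshelve. all: by end_near. Qed.

Lemma mlb_rate f c : is_min f X c ->
  bigO_inv (fun r => c%:E - mlb f (pseudo_moments g r))%E.
Proof.
move=> [[x0 Xx0 fx0] fmin]; have [C [C0 cert]] := certificate_rate fmin.
exists C; near=> r; apply: abse_sub_le.
  apply: le_ereal_inf_tmp => _ [y yP <-]; rewrite lee_fin -subr_ge0.
  have fr : cone g (2 * r) (f - (c - C / r%:R)%:C) by near: r.
  have := cone_riesz yP fr; rewrite -[X in riesz _ (_ + X)]scaleN1r.
  by rewrite rieszD rieszZ rieszC; have [-> _ _] := yP; rewrite mulr1 mulN1r.
apply: ereal_inf_lbound; exists (dirac_moments x0).
  exact/dirac_pseudo_moments/constraints_ge0.
rewrite riesz_dirac ?fx0 // ltnW // ltnS; near: r.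
exists (msize f) => // r /=; lia.
Unshelve. all: by end_near. Qed.

Local Notation BT := (@borel_Rn R n).

Lemma measurable_polytope : measurable (X : set BT).
Proof.
rewrite -[X]setCK; apply: measurableC; apply: sub_sigma_algebra.
exact/closed_openC/closed_polytope.
Qed.

Lemma measurable_peval p (D : set BT) : measurable D -> measurable_fun D (peval p : BT -> R).
Proof.
move=> mD; apply: measurable_funS (@measurableT _ BT) _ _ => //.
apply: (measurability _ (RGenOpens.measurableE R)).
move=> _ [_ [a [c ->] <-]]; rewrite setTI; apply: sub_sigma_algebra.
have /continuousP := @peval_continuous R n p; apply; exact: interval_open.
Qed.

Lemma monomial_bounded k : exists M, 0 <= M /\
  forall (a : exponents n k) x, X x -> `|peval (mpolyX R a) x| <= M.
Proof.
have bnd (a : exponents n k) : exists M, 0 <= M /\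
    forall x, X x -> `|peval (mpolyX R a) x| <= M.
  have [c [_ cmin]] := polytope_min (mpolyX R a).
  have [d [_ dmin]] := polytope_min (- mpolyX R a).
  exists (`|c| + `|d|); split=> [|x Xx]; first by rewrite addr_ge0.
  have := cmin x Xx; have := dmin x Xx; rewrite -[X in peval X x]scaleN1r pevalZ.
  have := ler_norm c; have := ler_norm (- c); have := ler_norm d; have := ler_norm (- d).
  rewrite !normrN ler_norml => h1 h2 h3 h4 h5 h6; apply/andP; split; lra.
have [M MP] := choice bnd.
exists (\sum_a M a); split=> [|a x Xx]; first by apply: sumr_ge0 => a _; have [] := MP a.
rewrite (bigD1 a) //= (le_trans ((MP a).2 x Xx)) // lerDl sumr_ge0 // => i _.
by have [] := MP i.
Qed.

Lemma moments_dirac k x : X x -> moments X k (dirac_moments x).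
Proof.
move=> Xx; exists (\d_(x : BT) : probability BT R); split.
  by rewrite /= diracE mem_set.
move=> a; rewrite integral_dirac.
- by rewrite diracE mem_set // mul1e.
- exact: measurable_polytope.
- by apply/measurable_EFinP; apply: measurable_peval; exact: measurable_polytope.
Qed.

Lemma moments_mix k (z : exponents n k -> R) x (t : R) : moments X k z -> X x -> 0 <= t <= 1 ->
  moments X k (fun a : exponents n k => (1 - t) * z a + t * dirac_moments x a).
Proof.
move=> [nu [nuX zE]] Xx /andP[t0 t1].
have t1' : 0 <= 1 - t by rewrite subr_ge0.
have mixE B : mixture t1' t0 nu (\d_(x : BT)) B =
    ((1 - t)%:E * nu B + t%:E * \d_(x : BT) B)%E by exact: measure_addE.
have mixT : mixture t1' t0 nu (\d_(x : BT)) setT = 1%E.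
  rewrite mixE probability_setT diracT !mule1 -EFinD; congr (_%:E); ring.
pose P : probability BT R := HB.pack (mixture t1' t0 nu (\d_(x : BT)))
  (Measure_isProbability.Build _ _ _ (mixture t1' t0 nu (\d_(x : BT))) mixT).
have PX : P X = 1%E.
  by rewrite /= mixE nuX diracE mem_set // !mule1 -EFinD; congr (_%:E); ring.
exists P; split=> //.
move=> a; have [M [M0 MP]] := monomial_bounded k.
pose f : BT -> R := peval (mpolyX R (bmnm a)).
have mX := measurable_polytope.
have mf : measurable_fun (X : set BT) f by exact: measurable_peval.
have bf : [bounded f y | y in X].
  exists M; split=> [|M' MM' y Xy]; first exact: num_real.
  exact: le_trans (MP a y Xy) (ltW MM').
have intf (Q : probability BT R) : Q X = 1%E ->
    (\int[Q]_(y in X) (f y + M)%:E = \int[Q]_(y in X) (f y)%:E + M%:E)%E.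
  move=> QX; have QXoo : (Q X < +oo)%E by rewrite QX ltry.
  under eq_integral do rewrite EFinD.
  rewrite integralD //=.
  - by rewrite integral_cst //= QX mule1.
  - exact: measurable_bounded_integrable.
  - apply/integrableP; split; first exact: measurable_cst.
    by rewrite integral_cst //= QX mule1 ltry.
have fM0 y : X y -> (0 <= (f y + M)%:E)%E.
  move=> Xy; rewrite lee_fin; have := MP a y Xy.
  by rewrite ler_norml => /andP[h _]; rewrite /f; lra.
have mfM : measurable_fun (X : set BT) (fun y => (f y + M)%:E).
  by apply/measurable_EFinP; apply: measurable_funD.
have := intf P PX.
rewrite ge0_integral_measure_add // !ge0_integral_mscale // (intf nu nuX) zE.
rewrite integral_dirac // diracE mem_set // mul1e /=.
set I0 := (\int[_]_(_ in _) _)%E => E.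
suff : I0 = ((1 - t) * z a + t * f x)%:E by [].
move: E; case: (I0) => [r| |] // [] E; congr (_%:E).
transitivity ((1 - t) * (z a + M) + t * (f x + M) - M); last ring.
by rewrite E addrK.
Qed.

Lemma riesz_restrict k l (y : exponents n l -> R) (f : exponents n k -> R) :
  (k <= l)%N -> riesz y (\sum_a f a *: mpolyX R (bmnm a)) =
  \sum_a f a * restrict_moments (k := k) y a.
Proof.
move=> kl; rewrite riesz_sum; apply: eq_bigr => a _; rewrite rieszZ; congr (_ * _).
have al : (mdeg a < l.+1)%N by exact: leq_trans (bmdeg a) _.
rewrite /restrict_moments insubT /= /riesz (bigD1 (BMultinom al)) //= big1 => [|c ca].
  by rewrite mcoeffX eqxx mul1r addr0.
rewrite mcoeffX; case: eqP => [ac|_]; last by rewrite mul0r.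
by case/eqP: ca; apply: val_inj; rewrite /= ac.
Qed.

Lemma moment_rate k : bigO_inv (moment_dist g X k).
Proof.
have [C [K [C0 cert]]] := effective_certificate X_ball rho_ge1 X_neq0 k.
have [M [M0 MP]] := monomial_bounded k.
have [x0 Xx0] := X_neq0.
exists C; near=> r.
have r0 : (0 < r)%N by near: r; exact: nbhs_infty_gt.
have kr : (k <= 2 * r)%N.
  by apply: (@leq_trans r); [near: r; exact: nbhs_infty_ge|rewrite leq_pmull].
have Kr : (K <= r)%N by near: r; exact: nbhs_infty_ge.
pose y0 : exponents n k -> R := restrict_moments (dirac_moments (k := 2 * r) x0).
rewrite /moment_dist gee0_abs; last first.
  apply: (@le_trans _ _ (edist_set y0 (moments X k))).
    by apply: le_ereal_inf_tmp => _ [z _ <-]; rewrite lee_fin sqrtr_ge0.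
  apply: ereal_sup_ubound; exists y0 => //.
  exists (dirac_moments x0) => //; exact/dirac_pseudo_moments/constraints_ge0.
apply: ge_ereal_sup => _ [_ [y yP <-] <-].
apply: (@edist_le_of_support _ _ _ [set dirac_moments x | x in X] _ _ M) => //.
- by rewrite divr_ge0.
- by exists (dirac_moments x0); exact: moments_dirac.
- by move=> z _ t zX [x Xx <-] t01; exact: moments_mix.
- by move=> _ a [x Xx <-]; exact: MP.
move=> f f1; pose F := \sum_a f a *: mpolyX R (bmnm a).
have coefF (a : exponents n k) : mcoeff a F = f a.
  rewrite /F (raddf_sum (mcoeff (bmnm a))) (bigD1 a) //= big1 => [|c ca].
    by rewrite mcoeffZ mcoeffX eqxx mulr1 addr0.
  rewrite mcoeffZ mcoeffX; case: eqP => [/val_inj ac|_]; last by rewrite mulr0.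
  by rewrite ac eqxx in ca.
have Fk : (msize F <= k.+1)%N.
  apply: (leq_trans (mmeasure_sum _ _ _ _)); apply/bigmax_leqP => a _.
  by rewrite (leq_trans (msizeZ_le _ _)) // msizeX bmdeg.
have [c [[x Xx Fx] cmin]] := polytope_min F.
exists (dirac_moments x); first by exists x.
have -> : \sum_a f a * dirac_moments x a = c.
  by rewrite -Fx /F peval_sum; apply: eq_bigr => a _; rewrite pevalZ.
rewrite -riesz_restrict //.
have := cone_riesz yP (cert F Fk _ c cmin r r0 Kr).
rewrite -[X in riesz _ (_ + X + _)]scaleN1r.
rewrite !rieszD rieszZ !rieszC; have [-> _ _] := yP; rewrite !mulr1 mulN1r -/F => h.
suff: 0 <= riesz y F - c + C / r%:R by lra.
by apply: h => a; rewrite coefF.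
Unshelve. all: by end_near. Qed.

End Rates.

Lemma enorm_le (R : realType) n (v : 'I_n -> R) e : 0 <= e -> (forall i, `|v i| <= e) ->
  enorm v <= n.+1%:R * e.
Proof.
move=> e0 ve; rewrite -[leRHS]ger0_norm ?mulr_ge0 // -sqrtr_sqr ler_wsqrtr //.
apply: (@le_trans _ _ (\sum_(i < n) e ^+ 2)).
  by apply: ler_sum => i _; rewrite -[v i ^+ 2]real_normK ?num_real // ler_sqr ?nnegrE.
rewrite sumr_const card_ord exprMn -(mulr_natl (e ^+ 2)) ler_wpM2r ?sqr_ge0 //.
by rewrite -natrX ler_nat; nia.
Qed.

Theorem theorem4p14 (R : realType) (m n : nat) (A : 'M[R]_(m, n))
    (b : 'cV[R]_m) (rho : R) :
  1 <= rho ->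
  polytope A b !=set0 ->
  polytope A b `<=` eball rho ->
  [/\ exists c : R, 0 < c /\ forall x : 'cV[R]_n, eball rho x ->
        (dist_set x (polytope A b) <=
           (c * \big[Num.max/0]_(j < m) (A *m x - b) j 0)%:E)%E,
      forall k : nat, (0 < k)%N ->
        bigO_inv (moment_dist (constraints A b rho) (polytope A b) k)
    & forall f : {mpoly R[n]}, exists fmin : R,
        [/\ is_min f (polytope A b) fmin,
            bigO_inv (fun r => fmin%:E -
              mlb f (reduced_pseudo_moments (constraints A b rho) r))%E,
            bigO_inv (fun r => fmin%:E -
              lb f (reduced_certificate (constraints A b rho) r))%E,
            bigO_inv (fun r => fmin%:E -
              mlb f (pseudo_moments (constraints A b rho) r))%E
          & bigO_inv (fun r => fmin%:E -
              lb f (truncated_preordering (constraints A b rho) r))%E]].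
Proof.
move=> rho1 X0 Xball; split.
- have [c [c0 cP]] := polytope_error_bound X0.
  exists (n.+1%:R * c + 1); split; first by rewrite ltr_wpDl // mulr_ge0.
  move=> x _; set e := \big[_/_]_(_ < _) _.
  have e0 : 0 <= e by exact: bigmax_ge_id.
  have [|y Xy xy] := cP x e e0.
    move=> j; have : (A *m x - b) j 0 <= e.
      by rewrite /e; exact: (le_bigmax_cond _ (fun j => (A *m x - b) j 0)).
    by rewrite !mxE; lra.
  apply: (@le_trans _ _ (enorm (fun i => coords x i - coords y i))%:E).
    by apply: ereal_inf_lbound; exists (coords y) => //; exists y.
  rewrite lee_fin (le_trans (enorm_le (mulr_ge0 c0 e0) xy)) //.
  by rewrite mulrDl mul1r mulrA lerDl.
- by move=> k _; exact: moment_rate.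
- move=> f; have [c cmin] := polytope_min rho1 X0 Xball f.
  by exists c; split=> //; [exact: mlb_rate|exact: lb_rate|exact: mlb_rate|exact: lb_rate].
Qed.
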